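(* Let $n\geq 1$ and $0\leq k<n$ be integers, and let $\varepsilon\in\{0,1\}$. Then \[ \int_0^\infty \frac{\sinh((2k+1)x)}{x\cosh^{2n+\varepsilon}x}\,dx = \sum_{p=1}^{n} \frac{\Phi\!\left(2\varepsilon-1,\,2p+\varepsilon,\,\frac12\right)}{\pi^{2p-1+\varepsilon}}\, [z^{2n-1+\varepsilon}]\,U_{2k}(z)(\arcsin z)^{2p-1+\varepsilon}. \]
   Context: $\Phi(q,s,a)=\sum_{j=0}^{\infty}\frac{q^j}{(j+a)^s}$ is the Lerch transcendent (in its domain of convergence). With $\beta(s)=\sum_{j\ge0}(-1)^j(2j+1)^{-s}$ the Dirichlet beta function and $\zeta$ the Riemann zeta function, $\Phi(2\varepsilon-1,2p+\varepsilon,\frac12)$ equals $2^{2p}\beta(2p)$ for $\varepsilon=0$ and $(2^{2p+1}-1)\zeta(2p+1)$ for $\varepsilon=1$. $U_m$ is the Chebyshev polynomial of the second kind, normalized by $U_m(\cos\theta)=\frac{\sin((m+1)\theta)}{\sin\theta}$. $[z^r]F(z)$ denotes the coefficient of $z^r$ in the expansion of $F$ at the origin; $\arcsin z$ is expanded as its Taylor series at $0$ (with $\arcsin 0=0$). *)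

(* Defs.v *)
From Stdlib Require Import Reals Factorial Lra Lia.
From Coquelicot Require Import Coquelicot.
Open Scope R_scope.

(* Real parameters with [0 < a]: [Rpower x s] is [x ^ s] only when [0 < x].
   [Series] is meaningful only where the series converges. *)
Definition lerch_phi (q s a : R) : R :=
  Series (fun j : nat => q ^ j / Rpower (INR j + a) s).

(* The recurrence defines U_m as a polynomial function on all of R; its values
   on [-1, 1] are pinned down by [chebyshev_U_cos]. *)
Fixpoint chebyshev_U (m : nat) (z : R) : R :=
  match m with
  | O => 1
  | S m1 =>
      match m1 with
      | O => 2 * z
      | S m2 => 2 * z * chebyshev_U m1 z - chebyshev_U m2 z
      end
  end.

Lemma chebyshev_U_cos (m : nat) (theta : R) :
  sin theta <> 0 ->
  chebyshev_U m (cos theta) = sin (INR (m + 1) * theta) / sin theta.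
Proof.
intros Hs.
enough (H : chebyshev_U m (cos theta) = sin (INR (m + 1) * theta) / sin theta /\
            chebyshev_U (S m) (cos theta) = sin (INR (S m + 1) * theta) / sin theta)
  by apply H.
induction m as [|m [IH1 IH2]].
- split.
  + simpl. rewrite Rmult_1_l. field. exact Hs.
  + replace (INR (1 + 1) * theta) with (2 * theta) by (simpl; ring).
    rewrite sin_2a. simpl. field. exact Hs.
- split; [exact IH2|].
  change (chebyshev_U (S (S m)) (cos theta)) with
    (2 * cos theta * chebyshev_U (S m) (cos theta) - chebyshev_U m (cos theta)).
  rewrite IH1, IH2.
  replace (INR (S (S m) + 1) * theta) with (INR (S m + 1) * theta + theta)
    by (rewrite !plus_INR, !S_INR; simpl; ring).
  replace (INR (m + 1) * theta) with (INR (S m + 1) * theta - theta)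
    by (rewrite !plus_INR, !S_INR; simpl; ring).
  rewrite sin_plus, sin_minus. field. exact Hs.
Qed.

(* [z^r] F(z). *)
Definition taylor_coef (F : R -> R) (r : nat) : R :=
  Derive_n F r 0 / INR (fact r).

Lemma taylor_coef_PSeries (a : nat -> R) (F : R -> R) (r : nat) :
  Rbar_lt 0 (CV_radius a) ->
  locally 0 (fun z => F z = PSeries a z) ->
  taylor_coef F r = a r.
Proof.
intros Ha HF. unfold taylor_coef.
rewrite (Derive_n_ext_loc F (PSeries a) r 0 HF).
rewrite (Derive_n_coef a r Ha).
field. apply INR_fact_neq_0.
Qed.

(* Main.v *)
Require Import Defs.
From Stdlib Require Import Reals.
From Coquelicot Require Import Coquelicot.
From Stdlib Require Import Factorial Lra Lia.
Open Scope R_scope.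

(** Put [s = 2 eps - 1], [a_j = (j + 1/2) pi] and
    [B_m(x) = 2 sum_j s^j Im (a_j - i x)^(-m)].  The partial fraction expansions of
    [sech] and [tanh] (obtained by testing the Dirichlet kernel against
    [cosh (x t)] and [sinh (x (1 - t))]) give, after differentiation,
    [sinh x / cosh^2 x = B_2] and [sinh x / cosh^3 x = B_3].  Both
    [G_M = sinh / cosh^(M+1)], through
    [(M+1)(M+2) G_(M+2) = M^2 G_M - G_M''], and the coefficients [z^M] of [arcsin^q z],
    through the differential equation of [arcsin^q], obey the same recurrence in [M]; hence
    [G_M = sum_q ([z^M] arcsin^q z) B_(q+1)], and multiplying by [U_(2k)] on both sides
    gives the integrand.  Finally [Im (a - i x)^(-m) / x] has integral
    [pi / (2 a^m)] over the half line, which summed over [j] is the Lerch value. *)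

(** * Dominated convergence for series *)

(** The recurrences in [M] advance by two, so the parity is fixed by [eps]: one chain starts from
    sech with [s = -1], the other from tanh with [s = 1]. The Chebyshev step works because
    multiplication by [cosh] turns [G_M] into [G_(M-1)], while the coefficient of [z^M] in [z F(z)]
    is the coefficient of [z^(M-1)] in [F(z)]; both sides thus obey the recurrence of [U_m], and
    [k < n] keeps the indices in range. The obstacle is order 1: the terms of the sech series decay
    only like [1 / j], so domination fails and the expansion has to be a statement about partial
    sums. After one derivative the terms are bounded by a multiple of [/ freq j ^ 2], and dominated
    convergence suffices from there on. Sum and integral are never exchanged. The series of the
    antiderivatives [rho] has a summable bound uniform in [x], so its derivative and its limits at
    the two ends of the half line give the integral. *)

Lemma ex_series_Rabs_le (f b : nat -> R) :
  (forall j, Rabs (f j) <= b j) -> ex_series b -> ex_series f.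
Proof. intros H Hb. exact (ex_series_le (V := R_CompleteNormedModule) f b H Hb). Qed.

Lemma series_abs_le (f b : nat -> R) :
  (forall j, Rabs (f j) <= b j) -> ex_series b -> Rabs (Series f) <= Series b.
Proof.
intros H Hb.
eapply Rle_trans.
- apply Series_Rabs, (ex_series_Rabs_le _ b); [|exact Hb].
  intros j. rewrite Rabs_Rabsolu. apply H.
- apply Series_le; [|exact Hb]. intros j. split; [apply Rabs_pos|apply H].
Qed.

Lemma ball_R (x y : R) (d : posreal) : ball x d y <-> Rabs (y - x) < d.
Proof. reflexivity. Qed.

Lemma filterlim_R {T : Type} {F : (T -> Prop) -> Prop} {FF : Filter F}
    (f : T -> R) (l : R) :
  filterlim f F (locally l) <-> forall e : posreal, F (fun t => Rabs (f t - l) < e).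
Proof. exact (filterlim_locally (U := R_UniformSpace) f l). Qed.

(** Stated for an arbitrary proper filter because it serves three times: for difference quotients at
    [locally' 0], and for the limits of the antiderivative at [at_right 0] and at [p_infty].
    Properness lets the limits inherit the bound [b]. *)
Lemma tannery {T : Type} {F : (T -> Prop) -> Prop} {FF : ProperFilter F}
    (f : nat -> T -> R) (l b : nat -> R) :
  ex_series b ->
  (forall j, filterlim (f j) F (locally (l j))) ->
  F (fun t => forall j, Rabs (f j t) <= b j) ->
  filterlim (fun t => Series (fun j => f j t)) F (locally (Series l)).
Proof.
intros Hb Hl Hf.
assert (Hlb : forall j, Rabs (l j) <= b j).
{ intros j. apply le_epsilon. intros e He.
  assert (H1 := proj1 (filterlim_R _ _) (Hl j) (mkposreal e He)).
  destruct (filter_ex _ (filter_and _ _ H1 Hf)) as [t [Ha Hc]].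
  specialize (Hc j). simpl in Ha.
  apply Rabs_def2 in Ha. unfold Rabs in *.
  destruct (Rcase_abs (l j)), (Rcase_abs (f j t)); lra. }
apply filterlim_R. intros e.
(* The two tails, of [f] and of [l], cost [e / 4] each; the finite head costs [e / 2]. *)
assert (He4 : 0 < e / 4) by (destruct e; simpl; lra).
assert (HN : exists N, (0 < N)%nat /\ Series (fun j => b (N + j)%nat) < e / 4).
{ destruct (proj1 (filterlim_R _ _) (Series_correct _ Hb) (mkposreal _ He4)) as [N HN].
  exists (S N). split; [lia|].
  specialize (HN N (le_n _)). simpl in HN.
  rewrite (Series_incr_n b (S N)) in HN by (lia || exact Hb).
  simpl pred in HN. rewrite sum_n_Reals in HN. apply Rabs_def2 in HN. lra. }
destruct HN as [N [HN0 HN]].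
assert (Hsum : filterlim (fun t => sum_f_R0 (fun j => f j t) (pred N)) F
                 (locally (sum_f_R0 l (pred N)))).
{ induction (pred N) as [|n IH]; simpl.
  - apply Hl.
  - apply (filterlim_comp_2 (G := locally (sum_f_R0 l n)) (H := locally (l (S n)))
             _ _ Rplus IH (Hl (S n))).
    apply (filterlim_plus (V := R_NormedModule)). }
assert (He2 : 0 < e / 2) by (destruct e; simpl; lra).
assert (H1 := proj1 (filterlim_R _ _) Hsum (mkposreal _ He2)).
generalize (filter_and _ _ H1 Hf). apply filter_imp.
intros t [Ha Hc]. simpl in Ha.
assert (Hbn : ex_series (fun j => b (N + j)%nat))
  by (apply (ex_series_incr_n (K := R_AbsRing) (V := R_NormedModule) b N), Hb).
rewrite (Series_incr_n (fun j => f j t) N), (Series_incr_n l N).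
2: exact HN0. 3: exact HN0.
2: exact (ex_series_Rabs_le _ _ Hlb Hb). 2: exact (ex_series_Rabs_le _ _ Hc Hb).
assert (Hd := series_abs_le (fun j => f (N + j)%nat t) _ (fun j => Hc (N + j)%nat) Hbn).
assert (Hd' := series_abs_le (fun j => l (N + j)%nat) _ (fun j => Hlb (N + j)%nat) Hbn).
apply Rabs_def2 in Ha. apply Rabs_le_between in Hd. apply Rabs_le_between in Hd'.
apply Rabs_def1; lra.
Qed.

(** The mean value theorem turns the bound on the derivatives into the same bound on the difference
    quotients, to which dominated convergence applies. *)
Lemma is_derive_Series (f df : nat -> R -> R) (b : nat -> R) (x : R) (d : posreal) :
  ex_series b ->
  (forall j y, Rabs (y - x) < d -> is_derive (f j) y (df j y)) ->
  (forall j y, Rabs (y - x) < d -> Rabs (df j y) <= b j) ->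
  (forall y, Rabs (y - x) < d -> ex_series (fun j => f j y)) ->
  is_derive (fun y => Series (fun j => f j y)) x (Series (fun j => df j x)).
Proof.
intros Hb Hd Hbd Hs.
assert (Hx : Rabs (x - x) < d) by (rewrite Rminus_diag, Rabs_R0; apply cond_pos).
assert (H : filterlim (fun h => Series (fun j => (f j (x + h) - f j x) / h)) (locally' 0)
              (locally (Series (fun j => df j x)))).
{ apply (tannery (FF := Rbar_locally'_filter 0) _ _ b Hb).
  - intros j. apply filterlim_R. intros e.
    destruct (proj1 (is_derive_Reals _ _ _) (Hd j x Hx) e (cond_pos e)) as [dl Hdl].
    exists dl. intros h Hh Hh0. apply Hdl; [exact Hh0|].
    apply (proj1 (ball_R _ _ _)) in Hh. rewrite Rminus_0_r in Hh. exact Hh.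
  - exists d. intros h Hh Hh0 j.
    apply (proj1 (ball_R _ _ _)) in Hh. rewrite Rminus_0_r in Hh.
    assert (Hin : forall c, Rmin x (x + h) <= c <= Rmax x (x + h) -> Rabs (c - x) < d).
    { intros c Hc. apply Rabs_def2 in Hh. unfold Rmin, Rmax in Hc.
      apply Rabs_def1; destruct (Rle_dec x (x + h)); lra. }
    destruct (MVT_gen (f j) x (x + h) (df j)) as [c [Hc Heq]].
    + intros c Hc. apply Hd, Hin. lra.
    + intros c Hc. apply derivable_continuous_pt, ex_derive_Reals_0.
      eexists. apply Hd, Hin, Hc.
    + rewrite Heq. replace (df j c * (x + h - x) / h) with (df j c) by (field; exact Hh0).
      apply Hbd, Hin, Hc. }
apply is_derive_Reals. intros e He.
destruct (filter_and _ _ (proj1 (filterlim_R _ _) H (mkposreal e He))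
            (ex_intro _ d (fun h Hh _ => Hh) : locally' 0 (fun h => ball 0 d h))) as [dl Hdl].
exists dl. intros h Hh0 Hh.
assert (Hb0 : ball 0 dl h).
{ apply (proj2 (ball_R _ _ _)). rewrite Rminus_0_r. exact Hh. }
destruct (Hdl h Hb0 Hh0) as [H1 H2]. simpl in H1.
apply (proj1 (ball_R _ _ _)) in H2. rewrite Rminus_0_r in H2.
rewrite <- Series_minus.
- replace (Series (fun n => f n (x + h) - f n x) / h)
    with (Series (fun j => (f j (x + h) - f j x) / h)); [exact H1|].
  unfold Rdiv. apply Series_scal_r.
- apply Hs. replace (x + h - x) with h by ring. exact H2.
- apply Hs, Hx.
Qed.

(** * Powers of 1 / (a - i x) *)

(* Real and imaginary parts of [(a - i x)^(-m)]. *)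
Fixpoint cpow (m : nat) (a x : R) : R * R :=
  match m with
  | O => (1, 0)
  | S m1 => ((a * fst (cpow m1 a x) - x * snd (cpow m1 a x)) / (a * a + x * x),
             (a * snd (cpow m1 a x) + x * fst (cpow m1 a x)) / (a * a + x * x))
  end.

Definition cre (m : nat) (a x : R) : R := fst (cpow m a x).
Definition cim (m : nat) (a x : R) : R := snd (cpow m a x).

Lemma cre_S (m : nat) (a x : R) :
  cre (S m) a x = (a * cre m a x - x * cim m a x) / (a * a + x * x).
Proof. reflexivity. Qed.

Lemma cim_S (m : nat) (a x : R) :
  cim (S m) a x = (a * cim m a x + x * cre m a x) / (a * a + x * x).
Proof. reflexivity. Qed.

Lemma is_derive_cre_cim (m : nat) (a x : R) : 0 < a ->
  is_derive (cre m a) x (- INR m * cim (S m) a x) /\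
  is_derive (cim m a) x (INR m * cre (S m) a x).
Proof.
intros Ha. induction m as [|m [IH1 IH2]].
- split.
  + apply (is_derive_ext (fun _ => 1)); [reflexivity|]. auto_derive; [exact I|simpl; ring].
  + apply (is_derive_ext (fun _ => 0)); [reflexivity|]. auto_derive; [exact I|simpl; ring].
- assert (HD : a * a + x * x <> 0) by nra.
  repeat (rewrite cre_S in * || rewrite cim_S in *). rewrite !S_INR.
  assert (E1 : ex_derive (cre m a) x) by (eexists; exact IH1).
  assert (E2 : ex_derive (cim m a) x) by (eexists; exact IH2).
  apply is_derive_unique in IH1. apply is_derive_unique in IH2.
  split.
  + apply (is_derive_ext (fun t => (a * cre m a t - t * cim m a t) / (a * a + t * t)));
      [reflexivity|].
    auto_derive; [auto|].
    change (Derive (fun t => cre m a t) x) with (Derive (cre m a) x).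
    change (Derive (fun t => cim m a t) x) with (Derive (cim m a) x).
    rewrite IH1, IH2. field. exact HD.
  + apply (is_derive_ext (fun t => (a * cim m a t + t * cre m a t) / (a * a + t * t)));
      [reflexivity|].
    auto_derive; [auto|].
    change (Derive (fun t => cre m a t) x) with (Derive (cre m a) x).
    change (Derive (fun t => cim m a t) x) with (Derive (cim m a) x).
    rewrite IH1, IH2. field. exact HD.
Qed.

(** The squared modulus of [(a - i x)^(-m)]. Discarding [x * x] bounds both parts uniformly in [x];
    keeping one factor [x * x] gives the decay at infinity in [cim_le]. *)
Lemma cpow_norm (m : nat) (a x : R) : 0 < a ->
  cre m a x * cre m a x + cim m a x * cim m a x = / (a * a + x * x) ^ m.
Proof.
intros Ha. assert (HD : 0 < a * a + x * x) by nra.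
induction m as [|m IH].
- unfold cre, cim; simpl. field.
- rewrite cre_S, cim_S. simpl pow. rewrite Rinv_mult, <- IH. field. lra.
Qed.

Lemma cre_cim_le (m : nat) (a x : R) : 0 < a ->
  Rabs (cre m a x) <= / a ^ m /\ Rabs (cim m a x) <= / a ^ m.
Proof.
intros Ha. assert (Hn := cpow_norm m a x Ha).
assert (Hp : 0 < a ^ m) by (apply pow_lt; exact Ha).
assert (Hb : / (a * a + x * x) ^ m <= (/ a ^ m) * (/ a ^ m)).
{ rewrite <- Rinv_mult, <- Rpow_mult_distr. apply Rinv_le_contravar.
  - apply pow_lt. nra.
  - apply pow_incr. nra. }
assert (Hi := Rinv_0_lt_compat _ Hp).
split; apply Rabs_le_between; split; nra.
Qed.

Lemma cim_le (m : nat) (a x : R) : 0 < a -> 0 < x ->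
  Rabs (cim (S m) a x) <= / (x * a ^ m).
Proof.
intros Ha Hx. assert (Hn := cpow_norm (S m) a x Ha).
assert (Hp : 0 < a ^ m) by (apply pow_lt; exact Ha).
assert (Hb : / (a * a + x * x) ^ S m <= (/ (x * a ^ m)) * (/ (x * a ^ m))).
{ rewrite <- Rinv_mult. apply Rinv_le_contravar.
  - repeat apply Rmult_lt_0_compat; assumption.
  - replace (x * a ^ m * (x * a ^ m)) with ((x * x) * (a * a) ^ m)
      by (rewrite Rpow_mult_distr; ring).
    apply Rmult_le_compat; [nra| apply pow_le; nra | nra |].
    apply pow_incr. nra. }
assert (Hi : 0 < / (x * a ^ m)) by (apply Rinv_0_lt_compat; nra).
apply Rabs_le_between; split; nra.
Qed.

Lemma cim_0 (m : nat) (a : R) : cim m a 0 = 0.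
Proof.
induction m as [|m IH]; [reflexivity|]. rewrite cim_S, IH. unfold Rdiv. ring.
Qed.

(* The antiderivative of [cim (S q) a x / x] vanishing at [0]; the recursion comes
   from [a Im w^(m+1) - x Re w^(m+1) = Im w^m] with [w = 1 / (a - i x)]. *)
Fixpoint rho (q : nat) (a x : R) : R :=
  match q with
  | O => atan (x / a) / a
  | S q1 => (rho q1 a x + cim (S q1) a x / INR (S q1)) / a
  end.

Lemma is_derive_rho (q : nat) (a x : R) : 0 < a -> x <> 0 ->
  is_derive (rho q a) x (cim (S q) a x / x).
Proof.
intros Ha Hx. assert (HD : a * a + x * x <> 0) by nra.
induction q as [|q IH].
- replace (cim 1 a x / x) with (/ (a * a + x * x)).
  2: { rewrite cim_S. unfold cre, cim; simpl. field. split; assumption. }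
  apply (is_derive_ext (fun t => atan (t / a) / a)); [reflexivity|].
  auto_derive; [lra|]. unfold Rsqr. field. repeat split; try exact HD; try lra; nra.
- apply (is_derive_ext (fun t => (rho q a t + cim (S q) a t / INR (S q)) / a));
    [reflexivity|].
  destruct (is_derive_cre_cim (S q) a x Ha) as [_ H2].
  assert (E1 : ex_derive (rho q a) x) by (eexists; exact IH).
  assert (E2 : ex_derive (cim (S q) a) x) by (eexists; exact H2).
  apply is_derive_unique in IH. apply is_derive_unique in H2.
  auto_derive; [auto|].
  change (Derive (fun t => rho q a t) x) with (Derive (rho q a) x).
  change (Derive (fun t => cim (S q) a t) x) with (Derive (cim (S q) a) x).
  rewrite IH, H2. rewrite (cim_S (S q)), (cre_S (S q)).
  set (c := cre (S q) a x). set (d := cim (S q) a x).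
  assert (INR (S q) <> 0) by (apply not_0_INR; lia).
  change (match q with 0%nat => 1 | S _ => INR q + 1 end) with (INR (S q)).
  field. repeat split; auto; lra.
Qed.

Lemma continuous_rho (q : nat) (a x : R) : 0 < a -> continuous (rho q a) x.
Proof.
intros Ha. induction q as [|q IH].
- apply (ex_derive_continuous (V := R_NormedModule)).
  apply (ex_derive_ext (fun t => atan (t / a) / a)); [reflexivity|].
  auto_derive. lra.
- apply (continuous_ext
    (fun t => scal (/ a) (plus (rho q a t) (scal (/ INR (S q)) (cim (S q) a t))))).
  + intros t. unfold scal, plus; simpl; unfold mult; simpl. unfold Rdiv. ring.
  + apply (continuous_scal_r (V := R_NormedModule)),
      (continuous_plus (V := R_NormedModule)); [exact IH|].
    apply (continuous_scal_r (V := R_NormedModule)).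
    apply (ex_derive_continuous (V := R_NormedModule)).
    eexists. apply (is_derive_cre_cim (S q) a x Ha).
Qed.

Lemma rho_0 (q : nat) (a : R) : rho q a 0 = 0.
Proof.
induction q as [|q IH].
- simpl. unfold Rdiv. rewrite Rmult_0_l, atan_0. ring.
- change (rho (S q) a 0) with ((rho q a 0 + cim (S q) a 0 / INR (S q)) / a).
  rewrite IH, cim_0. unfold Rdiv. ring.
Qed.

(** The arctangent is at most 2 in absolute value, and each step of the recursion adds at most
    [/ a ^ S q] before the division by [a]. The bound is uniform in [x], so it dominates the series
    at both ends of the half line. *)
Lemma rho_le (q : nat) (a x : R) : 0 < a ->
  Rabs (rho q a x) <= INR (q + 2) * / a ^ S q.
Proof.
intros Ha. assert (Hia : 0 < / a) by (apply Rinv_0_lt_compat; exact Ha).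
induction q as [|q IH].
- simpl. unfold Rdiv. rewrite Rabs_mult, (Rabs_right (/ a)), Rmult_1_r by lra.
  apply Rmult_le_compat_r; [lra|].
  destruct (atan_bound (x * / a)). assert (H1 := PI_4).
  apply Rabs_le_between. lra.
- change (rho (S q) a x) with ((rho q a x + cim (S q) a x / INR (S q)) / a).
  destruct (cre_cim_le (S q) a x Ha) as [_ H].
  assert (HS : 1 <= INR (S q)) by (rewrite S_INR; generalize (pos_INR q); lra).
  assert (Hc : Rabs (cim (S q) a x / INR (S q)) <= / a ^ S q).
  { unfold Rdiv. rewrite Rabs_mult, (Rabs_right (/ INR (S q)))
      by (apply Rle_ge, Rlt_le, Rinv_0_lt_compat, lt_0_INR; lia).
    assert (/ INR (S q) <= 1) by (rewrite <- Rinv_1; apply Rinv_le_contravar; lra).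
    eapply Rle_trans; [|exact H]. rewrite <- (Rmult_1_r (Rabs _)) at 2.
    apply Rmult_le_compat_l; [apply Rabs_pos|assumption]. }
  unfold Rdiv at 1. rewrite Rabs_mult, (Rabs_right (/ a)) by lra.
  replace (INR (S q + 2) * / a ^ S (S q)) with ((INR (q + 2) * / a ^ S q + / a ^ S q) * / a).
  + apply Rmult_le_compat_r; [lra|]. eapply Rle_trans; [apply Rabs_triang|]. lra.
  + change (S q + 2)%nat with (S (q + 2)). rewrite S_INR.
    change (a ^ S (S q)) with (a * a ^ S q). field.
    split; [apply pow_nonzero; lra|lra].
Qed.

Lemma atan_le (x : R) : 0 <= x -> atan x <= x.
Proof.
intros Hx. destruct (Req_dec x 0) as [->|H0]; [rewrite atan_0; lra|].
destruct (MVT_gen atan 0 x (fun t => / (1 + t ^ 2))) as [c [Hc E]].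
- intros t _. apply is_derive_Reals, derivable_pt_lim_atan.
- intros t _. apply derivable_continuous_pt. eexists. apply derivable_pt_lim_atan.
- rewrite atan_0, !Rminus_0_r in E. rewrite E.
  assert (/ (1 + c ^ 2) <= 1) by (rewrite <- Rinv_1; apply Rinv_le_contravar; nra).
  nra.
Qed.

(** For [q = 0] the error is [atan (a / x) / a], by the reflection of the arctangent. Each later
    step adds a term [cim], which decays like [/ x]; only the arctangent contributes to the
    limit. *)
Lemma rho_lim_le (q : nat) (a x : R) : 0 < a -> 0 < x ->
  Rabs (rho q a x - PI / 2 * / a ^ S q) <= INR (S q) * / (x * a ^ q).
Proof.
intros Ha Hx. assert (Hia : 0 < / a) by (apply Rinv_0_lt_compat; exact Ha).
induction q as [|q IH].
- assert (Hxa : 0 < a / x) by (apply Rdiv_lt_0_compat; assumption).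
  assert (H1 := atan_inv _ Hxa). assert (H2 := atan_le (a / x) (Rlt_le _ _ Hxa)).
  replace (/ (a / x)) with (x / a) in H1 by (field; lra).
  simpl. rewrite H1.
  replace ((PI / 2 - atan (a / x)) / a - PI / 2 * / (a * 1)) with (- (atan (a / x) * / a))
    by (field; lra).
  assert (H3 : 0 < atan (a / x)) by (rewrite <- atan_0; apply atan_increasing; exact Hxa).
  rewrite Rabs_Ropp, Rabs_right by nra.
  replace (1 * / (x * 1)) with (a / x * / a) by (field; lra). nra.
- change (rho (S q) a x) with ((rho q a x + cim (S q) a x / INR (S q)) / a).
  assert (H := cim_le q a x Ha Hx).
  assert (HS : 1 <= INR (S q)) by (rewrite S_INR; generalize (pos_INR q); lra).
  assert (Hc : Rabs (cim (S q) a x / INR (S q)) <= / (x * a ^ q)).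
  { unfold Rdiv. rewrite Rabs_mult, (Rabs_right (/ INR (S q)))
      by (apply Rle_ge, Rlt_le, Rinv_0_lt_compat, lt_0_INR; lia).
    assert (/ INR (S q) <= 1) by (rewrite <- Rinv_1; apply Rinv_le_contravar; lra).
    eapply Rle_trans; [|exact H]. rewrite <- (Rmult_1_r (Rabs _)) at 2.
    apply Rmult_le_compat_l; [apply Rabs_pos|assumption]. }
  assert (Hp : a ^ q <> 0) by (apply pow_nonzero; lra).
  replace ((rho q a x + cim (S q) a x / INR (S q)) / a - PI / 2 * / a ^ S (S q)) with
    (((rho q a x - PI / 2 * / a ^ S q) + cim (S q) a x / INR (S q)) * / a).
  2: { simpl pow. field. repeat split; auto; lra. }
  rewrite Rabs_mult, (Rabs_right (/ a)) by lra.
  rewrite (S_INR (S q)).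
  replace ((INR (S q) + 1) * / (x * a ^ S q)) with
    ((INR (S q) * / (x * a ^ q) + / (x * a ^ q)) * / a) by (simpl pow; field; repeat split; auto; lra).
  apply Rmult_le_compat_r; [lra|]. eapply Rle_trans; [apply Rabs_triang|]. lra.
Qed.

Lemma rho_lim (q : nat) (a : R) : 0 < a ->
  filterlim (rho q a) (Rbar_locally p_infty) (locally (PI / 2 * / a ^ S q)).
Proof.
intros Ha. apply filterlim_R. intros e.
assert (Hp : 0 < a ^ q) by (apply pow_lt; exact Ha).
assert (HS : 0 < INR (S q)) by (apply lt_0_INR; lia).
exists (INR (S q) / a ^ q / e). intros x Hx.
assert (Hq : 0 < INR (S q) / a ^ q / e)
  by (apply Rdiv_lt_0_compat; [apply Rdiv_lt_0_compat|apply cond_pos]; assumption).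
eapply Rle_lt_trans; [apply rho_lim_le; [exact Ha|lra]|].
assert (He := cond_pos e).
apply (Rmult_lt_reg_r (x / e)); [apply Rdiv_lt_0_compat; lra|].
replace (INR (S q) * / (x * a ^ q) * (x / e)) with (INR (S q) / a ^ q / e) by (field; lra).
replace (e * (x / e)) with x by (field; lra). exact Hx.
Qed.

(** * The Dirichlet kernel *)

(** The numbers [i * freq j] are the zeros of the complex cosh in the upper half plane. *)
Definition freq (j : nat) : R := (INR j + 1 / 2) * PI.

Lemma PI_ge_3 : 3 <= PI.
Proof. generalize PI2_3_2. unfold PI2. lra. Qed.

Lemma freq_ge (j : nat) : INR j + 1 <= freq j.
Proof. unfold freq. assert (H := PI_ge_3). assert (H1 := pos_INR j). nra. Qed.

Lemma freq_pos (j : nat) : 0 < freq j.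
Proof. generalize (freq_ge j) (pos_INR j). lra. Qed.

Lemma cos_sin_freq (j : nat) : cos (freq j) = 0 /\ sin (freq j) = (-1) ^ j.
Proof.
induction j as [|j [IH1 IH2]].
- unfold freq. simpl. replace ((0 + 1 / 2) * PI) with (PI / 2) by field.
  split; [apply cos_PI2|apply sin_PI2].
- replace (freq (S j)) with (freq j + PI) by (unfold freq; rewrite S_INR; ring).
  rewrite neg_cos, neg_sin, IH1, IH2. simpl. split; ring.
Qed.

Definition dirichlet (N : nat) (t : R) : R := sum_f_R0 (fun j => 2 * cos (freq j * t)) N.
(** The antiderivative of [dirichlet N] that vanishes at 0; these are the Fourier partial sums of a
    square wave equal to 1 on (0, 2). *)
Definition square_wave (N : nat) (t : R) : R :=
  sum_f_R0 (fun j => 2 * sin (freq j * t) / freq j) N.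

Lemma dirichlet_closed (N : nat) (t : R) :
  dirichlet N t * sin (PI * t / 2) = sin (INR (S N) * PI * t).
Proof.
assert (H : forall j, 2 * cos (freq j * t) * sin (PI * t / 2) =
                      sin (INR (S j) * PI * t) - sin (INR j * PI * t)).
{ intros j. unfold freq. rewrite S_INR.
  replace ((INR j + 1) * PI * t) with ((INR j + 1 / 2) * PI * t + PI * t / 2) by field.
  replace (INR j * PI * t) with ((INR j + 1 / 2) * PI * t - PI * t / 2) by field.
  rewrite sin_plus, sin_minus. ring. }
unfold dirichlet. induction N as [|N IH].
- simpl sum_f_R0. rewrite H. simpl. rewrite !Rmult_0_l, sin_0. ring.
- rewrite tech5, Rmult_plus_distr_r, IH, H. ring.
Qed.

Lemma square_wave_0 (N : nat) : square_wave N 0 = 0.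
Proof.
unfold square_wave. induction N as [|N IH]; simpl sum_f_R0; [|rewrite IH];
  rewrite Rmult_0_r, sin_0; unfold Rdiv; ring.
Qed.

Lemma is_derive_square_wave (N : nat) (t : R) :
  is_derive (square_wave N) t (dirichlet N t).
Proof.
unfold square_wave, dirichlet.
assert (H : forall j, is_derive (fun y => 2 * sin (freq j * y) / freq j) t (2 * cos (freq j * t))).
{ intros j. generalize (freq_pos j). intros Hj. auto_derive; [exact I|]. field. lra. }
induction N as [|N IH].
- apply H.
- simpl. apply (is_derive_plus (V := R_NormedModule) _ _ _ _ _ IH (H (S N))).
Qed.

Lemma dirichlet_le (N : nat) (t : R) : Rabs (dirichlet N t) <= 2 * INR (S N).
Proof.
assert (H : forall j, Rabs (2 * cos (freq j * t)) <= 2).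
{ intros j. apply Rabs_le_between. generalize (COS_bound (freq j * t)). lra. }
unfold dirichlet. induction N as [|N IH].
- simpl. eapply Rle_trans; [apply H|]. lra.
- rewrite tech5. eapply Rle_trans; [apply Rabs_triang|].
  rewrite (S_INR (S N)). generalize (H (S N)). lra.
Qed.

(** A crude Jordan inequality: [sin y >= y - y^3 / 6] and [y <= 2]. *)
Lemma sin_ge (y : R) : 0 <= y <= PI / 2 -> y / 3 <= sin y.
Proof.
intros [H1 H2]. assert (H4 := PI_4).
destruct (sin_bound y 0) as [H _]; [lra|lra|].
unfold sin_approx, sin_term in H. simpl in H.
eapply Rle_trans; [|exact H]. field_simplify. nra.
Qed.

(** Integrating the closed form of the kernel once suggests the correction [(cos (M PI y) + r) / (M
    PI sin (PI y / 2))], with [M = INR (S N)]. In the derivative of the corrected sum the kernel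
    cancels, and what remains has the sign of [-(cos (M PI y) + r)]. With [r = 1] the corrected sum
    is nonincreasing on [t, 1], which gives the lower bound; with [r = -1] it is nondecreasing,
    which gives the upper one. *)
Lemma square_wave_le_sin (N : nat) (t : R) : 0 < t <= 1 ->
  Rabs (square_wave N t - square_wave N 1) <= 2 / (INR (S N) * PI * sin (PI * t / 2)).
Proof.
intros Ht. assert (HM : 0 < INR (S N)) by (apply lt_0_INR; lia).
assert (HP := PI_ge_3).
assert (Hs : forall y, t <= y <= 1 -> 0 < sin (PI * y / 2)).
{ intros y Hy. apply sin_gt_0; nra. }
assert (Hc : forall y, t <= y <= 1 -> 0 <= cos (PI * y / 2)).
{ intros y Hy. apply cos_ge_0; nra. }
assert (HQ : forall r, exists c, t <= c <= 1 /\
  square_wave N 1 + (cos (INR (S N) * PI * 1) + r) / (INR (S N) * PI * sin (PI * 1 / 2)) -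
  (square_wave N t + (cos (INR (S N) * PI * t) + r) / (INR (S N) * PI * sin (PI * t / 2)))
  = - (cos (INR (S N) * PI * c) + r) * (PI / 2 * cos (PI * c / 2) /
      (INR (S N) * PI * (sin (PI * c / 2) * sin (PI * c / 2)))) * (1 - t)).
{ intros r.
  assert (Hd : forall y, t <= y <= 1 -> is_derive
     (fun y => square_wave N y +
       (cos (INR (S N) * PI * y) + r) / (INR (S N) * PI * sin (PI * y / 2)))
     y (- (cos (INR (S N) * PI * y) + r) * (PI / 2 * cos (PI * y / 2) /
      (INR (S N) * PI * (sin (PI * y / 2) * sin (PI * y / 2)))))).
  { intros y Hy. specialize (Hs y Hy).
    assert (H1 := is_derive_square_wave N y).
    assert (E1 : ex_derive (square_wave N) y) by (eexists; exact H1).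
    apply is_derive_unique in H1.
    set (M := INR (S N)) in *.
    assert (Hcl : dirichlet N y = sin (M * PI * y) / sin (PI * y / 2)).
    { unfold M. rewrite <- dirichlet_closed. field. lra. }
    rewrite Hcl in H1. clearbody M.
    auto_derive.
    - repeat split; auto. apply Rmult_integral_contrapositive_currified; [nra|].
      unfold Rdiv in Hs. lra.
    - change (Derive (fun t => square_wave N t) y) with (Derive (square_wave N) y).
      rewrite H1. unfold Rdiv in *. field. repeat split; lra. }
  destruct (MVT_gen (fun y => square_wave N y +
       (cos (INR (S N) * PI * y) + r) / (INR (S N) * PI * sin (PI * y / 2))) t 1
    (fun y => - (cos (INR (S N) * PI * y) + r) * (PI / 2 * cos (PI * y / 2) /
      (INR (S N) * PI * (sin (PI * y / 2) * sin (PI * y / 2)))))) as [c [Hcc E]];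
   rewrite ?Rmin_left, ?Rmax_right in * by lra.
  - intros y Hy. apply Hd. lra.
  - intros y Hy. apply derivable_continuous_pt, ex_derive_Reals_0. eexists. apply Hd, Hy.
  - exists c. split; [exact Hcc|exact E]. }
assert (Hpos : forall c, t <= c <= 1 ->  0 <= PI / 2 * cos (PI * c / 2) /
      (INR (S N) * PI * (sin (PI * c / 2) * sin (PI * c / 2)))).
{ intros c Hcc. specialize (Hs c Hcc). specialize (Hc c Hcc).
  apply Rdiv_le_0_compat; [apply Rmult_le_pos; [lra|exact Hc]|].
  apply Rmult_lt_0_compat; [nra|]; try apply Rmult_lt_0_compat; assumption. }
assert (Hi : 0 < / (INR (S N) * PI * sin (PI * t / 2))).
{ apply Rinv_0_lt_compat. specialize (Hs t ltac:(lra)).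
  apply Rmult_lt_0_compat; [nra|]; try apply Rmult_lt_0_compat; assumption. }
assert (Hi1 : 0 < / (INR (S N) * PI * sin (PI * 1 / 2))).
{ apply Rinv_0_lt_compat. specialize (Hs 1 ltac:(lra)).
  apply Rmult_lt_0_compat; [nra|]; try apply Rmult_lt_0_compat; assumption. }
assert (Hb := fun y => COS_bound y).
apply Rabs_le_between. split.
- destruct (HQ 1) as [c [Hcc E]].
  specialize (Hpos c Hcc).
  set (A := cos (INR (S N) * PI * c)) in *.
  assert (HA : -1 <= A <= 1) by apply Hb.
  assert (B1 := Hb (INR (S N) * PI * 1)). assert (Bt := Hb (INR (S N) * PI * t)).
  unfold Rdiv in *.
  match type of Hpos with 0 <= ?W => set (w := W) in * end.
  clearbody A w.
  assert (0 <= (A + 1) * w * (1 - t)) by (repeat apply Rmult_le_pos; lra).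
  nra.
- destruct (HQ (-1)) as [c [Hcc E]].
  specialize (Hpos c Hcc).
  set (A := cos (INR (S N) * PI * c)) in *.
  assert (HA : -1 <= A <= 1) by apply Hb.
  assert (B1 := Hb (INR (S N) * PI * 1)). assert (Bt := Hb (INR (S N) * PI * t)).
  unfold Rdiv in *.
  match type of Hpos with 0 <= ?W => set (w := W) in * end.
  clearbody A w.
  assert (0 <= (1 - A) * w * (1 - t)) by (repeat apply Rmult_le_pos; lra).
  nra.
Qed.

Lemma square_wave_le_far (N : nat) (t : R) : 0 < t <= 1 ->
  Rabs (square_wave N t - square_wave N 1) <= 2 / (INR (S N) * t).
Proof.
intros Ht. assert (HM : 0 < INR (S N)) by (apply lt_0_INR; lia).
assert (HP := PI_ge_3).
eapply Rle_trans; [apply square_wave_le_sin; exact Ht|].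
apply Rmult_le_compat_l; [lra|]. apply Rinv_le_contravar; [nra|].
rewrite Rmult_assoc. apply Rmult_le_compat_l; [lra|].
assert (H : PI * t / 2 / 3 <= sin (PI * t / 2)) by (apply sin_ge; split; nra).
apply Rle_trans with (PI * (PI * t / 2 / 3)).
- assert (3 * t <= PI * t) by nra. assert (9 * t <= PI * (PI * t)) by nra. lra.
- apply Rmult_le_compat_l; lra.
Qed.

(** From [/ INR (S N)] on, the previous bound gives 2. Below that point the kernel is at most
    [2 * INR (S N)] on an interval of length at most [/ INR (S N)], which adds 2 more. *)
Lemma square_wave_le (N : nat) (t : R) : 0 <= t <= 1 ->
  Rabs (square_wave N t - square_wave N 1) <= 4.
Proof.
intros Ht. assert (HM : 1 <= INR (S N)) by (rewrite S_INR; generalize (pos_INR N); lra).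
assert (Hi : 0 < / INR (S N)) by (apply Rinv_0_lt_compat; lra).
assert (Hi1 : / INR (S N) <= 1) by (rewrite <- Rinv_1; apply Rinv_le_contravar; lra).
destruct (Rle_dec (/ INR (S N)) t) as [H|H].
- eapply Rle_trans; [apply square_wave_le_far; lra|].
  apply (Rmult_le_reg_r (INR (S N) * t)); [nra|].
  unfold Rdiv. rewrite Rmult_assoc, Rinv_l by nra.
  assert (INR (S N) * / INR (S N) = 1) by (field; lra). nra.
- assert (H1 := square_wave_le_far N (/ INR (S N)) (conj Hi Hi1)).
  rewrite Rinv_r in H1 by lra.
  destruct (MVT_gen (square_wave N) t (/ INR (S N)) (dirichlet N)) as [c [_ E]].
  + intros y _. apply is_derive_square_wave.
  + intros y _. apply derivable_continuous_pt, ex_derive_Reals_0. eexists.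
    apply is_derive_square_wave.
  + assert (Hd := dirichlet_le N c).
    replace (square_wave N t - square_wave N 1) with
      ((square_wave N (/ INR (S N)) - square_wave N 1) - dirichlet N c * (/ INR (S N) - t)) by lra.
    eapply Rle_trans; [apply Rabs_triang|]. rewrite Rabs_Ropp, Rabs_mult.
    rewrite (Rabs_right (/ INR (S N) - t)) by lra.
    assert (INR (S N) * / INR (S N) = 1) by (field; lra).
    assert (Rabs (dirichlet N c) * (/ INR (S N) - t) <= 2 * INR (S N) * / INR (S N)).
    { apply Rmult_le_compat; try lra. apply Rabs_pos. }
    lra.
Qed.

(** At [t = 1] the sine is [(-1) ^ j], and the sum is [4 / PI] times the alternating Leibniz series
    for [PI / 4]. *)
Lemma square_wave_1_lim : is_lim_seq (fun N => square_wave N 1) 1.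
Proof.
assert (HP := PI_ge_3).
assert (H := Alt_PI_eq). unfold Alt_PI in H.
destruct exist_PI as [l Hl]. apply is_lim_seq_Reals in Hl.
apply (is_lim_seq_scal_l _ (4 / PI)) in Hl.
replace (Finite 1) with (Finite (4 / PI * l)) by (f_equal; rewrite <- H; field; lra).
eapply is_lim_seq_ext; [|exact Hl].
intros N. simpl. unfold square_wave. rewrite scal_sum. apply sum_eq.
intros j _. unfold tg_alt, PI_tg. rewrite Rmult_1_r.
destruct (cos_sin_freq j) as [_ ->]. unfold freq.
rewrite plus_INR, mult_INR. simpl. assert (H1 := pos_INR j). field. lra.
Qed.

(** Integration by parts against [square_wave N t - square_wave N 1], which vanishes at 1, leaves
    only the boundary term [F 0 * square_wave N 1]. The remaining integral is split at [d]: the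
    uniform bound 4 controls [0, d], and the bound in [/ (INR (S N) * d)] controls [d, 1]. *)
Lemma is_lim_RInt_dirichlet (F dF : R -> R) :
  (forall t, is_derive F t (dF t)) -> (forall t, continuous dF t) ->
  is_lim_seq (fun N => RInt (fun t => F t * dirichlet N t) 0 1) (F 0).
Proof.
intros HF HdF.
assert (HFc : forall t, continuous F t).
{ intros t. apply (ex_derive_continuous (V := R_NormedModule)). eexists. apply HF. }
assert (Hcs : forall N t, continuous (square_wave N) t).
{ intros N t. apply (ex_derive_continuous (V := R_NormedModule)). eexists.
  apply is_derive_square_wave. }
assert (Hcd : forall N t, continuous (dirichlet N) t).
{ intros N t. assert (Hj : forall j, continuous (fun t => 2 * cos (freq j * t)) t).
  { intros j. apply (ex_derive_continuous (V := R_NormedModule)). auto_derive. exact I. }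
  unfold dirichlet. induction N as [|N IH]; simpl; [apply Hj|].
  apply (continuous_plus (V := R_NormedModule) _ _ _ IH (Hj (S N))). }
destruct (bounded_continuity dF 0 1) as [K HK].
{ intros t _. apply HdF. }
assert (HK0 : 0 < K).
{ eapply Rle_lt_trans; [apply (Rabs_pos (dF 0))|]. apply (HK 0). lra. }
assert (Hc2 : forall N t, continuous (fun t => dF t * (square_wave N t - square_wave N 1)) t).
{ intros N t. apply (continuous_mult (K := R_AbsRing)); [apply HdF|].
  apply (continuous_minus (V := R_NormedModule)); [apply Hcs|apply continuous_const]. }
assert (Hex : forall N a b, ex_RInt (fun t => dF t * (square_wave N t - square_wave N 1)) a b).
{ intros N a b. apply (ex_RInt_continuous (V := R_CompleteNormedModule)). intros t _. apply Hc2. }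
assert (Hex1 : forall N, ex_RInt (fun t => F t * dirichlet N t) 0 1).
{ intros N. apply (ex_RInt_continuous (V := R_CompleteNormedModule)). intros t _.
  apply (continuous_mult (K := R_AbsRing)); [apply HFc|apply Hcd]. }
assert (Hparts : forall N, RInt (fun t => F t * dirichlet N t) 0 1 =
  F 0 * square_wave N 1 - RInt (fun t => dF t * (square_wave N t - square_wave N 1)) 0 1).
{ intros N.
  assert (H := is_RInt_scal_derive F (fun t => square_wave N t - square_wave N 1) dF
                 (dirichlet N) 0 1 (fun t _ => HF t)).
  specialize (H ltac:(intros t _;
    apply (is_derive_ext (fun t => square_wave N t + - square_wave N 1)); [reflexivity|];
    rewrite <- (Rplus_0_r (dirichlet N t));
    apply (is_derive_plus (V := R_NormedModule) (square_wave N) (fun _ => - square_wave N 1));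
      [apply is_derive_square_wave|apply (is_derive_const (V := R_NormedModule))])
    (fun t _ => HdF t) (fun t _ => Hcd N t)).
  apply is_RInt_unique in H.
  unfold minus, plus, opp, scal in H; simpl in H; unfold mult in H; simpl in H.
  rewrite (RInt_plus (V := R_CompleteNormedModule)
    (fun t => dF t * (square_wave N t - square_wave N 1))
    (fun t => F t * dirichlet N t)) in H by auto.
  unfold plus in H; simpl in H. rewrite square_wave_0 in H. lra. }
assert (Hbound : forall d N, 0 < d <= 1 ->
  Rabs (RInt (fun t => dF t * (square_wave N t - square_wave N 1)) 0 1) <=
  K * (4 * d + 2 / (INR (S N) * d))).
{ intros d N Hd. assert (HM : 0 < INR (S N)) by (apply lt_0_INR; lia).
  rewrite <- (RInt_Chasles _ 0 d 1) by auto.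
  eapply Rle_trans; [apply (Rabs_triang (RInt _ 0 d) (RInt _ d 1))|].
  assert (Hm : forall t B, 0 <= t <= 1 -> Rabs (square_wave N t - square_wave N 1) <= B ->
    Rabs (dF t * (square_wave N t - square_wave N 1)) <= K * B).
  { intros t B Ht HB. rewrite Rabs_mult.
    apply Rmult_le_compat; [apply Rabs_pos|apply Rabs_pos| |exact HB].
    apply Rlt_le, (HK t Ht). }
  assert (H1 := abs_RInt_le_const (fun t => dF t * (square_wave N t - square_wave N 1))
     0 d (K * 4) ltac:(lra) (Hex _ _ _)
     ltac:(intros t Ht; apply Hm; [lra|apply square_wave_le; lra])).
  assert (H2 := abs_RInt_le_const (fun t => dF t * (square_wave N t - square_wave N 1))
     d 1 (K * (2 / (INR (S N) * d))) ltac:(lra) (Hex _ _ _)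
     ltac:(intros t Ht; apply Hm; [lra|];
       eapply Rle_trans; [apply square_wave_le_far; lra|];
       apply Rmult_le_compat_l; [lra|]; apply Rinv_le_contravar; nra)).
  assert (0 < 2 / (INR (S N) * d)) by (apply Rdiv_lt_0_compat; nra).
  eapply Rle_trans; [apply Rplus_le_compat; [exact H1|exact H2]|].
  assert (0 < K * (2 / (INR (S N) * d))) by nra. nra. }
assert (Hz : is_lim_seq
  (fun N => RInt (fun t => dF t * (square_wave N t - square_wave N 1)) 0 1) 0).
{ apply is_lim_seq_Reals. intros e He.
  (* This makes the part near 0 smaller than [e / 2]; [N0] is then chosen so that the far part is
     below [e / 2] as well. *)
  set (d := Rmin 1 (e / (8 * K + 1))).
  assert (Hd : 0 < d <= 1).
  { unfold d. split; [apply Rmin_pos; [lra|apply Rdiv_lt_0_compat; lra]|apply Rmin_l]. }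
  assert (Hd2 : d * (8 * K + 1) <= e).
  { apply Rle_trans with (e / (8 * K + 1) * (8 * K + 1)).
    - apply Rmult_le_compat_r; [lra|apply Rmin_r].
    - right. field. lra. }
  destruct (INR_unbounded (4 * K / (d * e))) as [N0 HN0].
  exists N0. intros N HN. unfold Rdist. rewrite Rminus_0_r.
  eapply Rle_lt_trans; [apply (Hbound d N Hd)|].
  assert (HNN : INR N0 < INR (S N)) by (apply lt_INR; lia).
  assert (HM : 0 < INR (S N)) by (apply lt_0_INR; lia).
  assert (H3 : K * (2 / (INR (S N) * d)) < e / 2).
  { apply (Rmult_lt_reg_r (INR (S N) * d * 2)); [nra|].
    replace (K * (2 / (INR (S N) * d)) * (INR (S N) * d * 2)) with (4 * K) by (field; lra).
    replace (e / 2 * (INR (S N) * d * 2)) with (INR (S N) * (d * e)) by field.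
    replace (4 * K) with (4 * K / (d * e) * (d * e)) by (field; lra).
    apply Rmult_lt_compat_r; nra. }
  nra. }
replace (Finite (F 0)) with (Finite (F 0 * 1 - 0)) by (f_equal; ring).
eapply is_lim_seq_ext; [intros N; symmetry; apply Hparts|].
apply is_lim_seq_minus'; [|exact Hz].
apply (is_lim_seq_scal_l _ (F 0) 1), square_wave_1_lim.
Qed.

(** Fourier inversion at the point 0. Passing explicit antiderivatives [P j] gives the coefficients
    in closed form, with no integral in the statement. *)
Lemma is_series_cos_coef (F dF : R -> R) (P : nat -> R -> R) :
  (forall t, is_derive F t (dF t)) -> (forall t, continuous dF t) ->
  (forall j t, is_derive (P j) t (F t * (2 * cos (freq j * t)))) ->
  is_series (fun j => P j 1 - P j 0) (F 0).
Proof.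
intros HF HdF HP.
change (is_lim_seq (sum_n (fun j => P j 1 - P j 0)) (F 0)).
apply (is_lim_seq_ext (fun N => RInt (fun t => F t * dirichlet N t) 0 1)).
2: exact (is_lim_RInt_dirichlet F dF HF HdF).
intros N. apply is_RInt_unique. rewrite sum_n_Reals.
assert (Hj : forall j, is_RInt (fun t => F t * (2 * cos (freq j * t))) 0 1 (P j 1 - P j 0)).
{ intros j. apply (is_RInt_derive (V := R_CompleteNormedModule)); [intros t _; apply HP|].
  intros t _. apply (ex_derive_continuous (V := R_NormedModule)).
  assert (E : ex_derive F t) by (eexists; apply HF).
  auto_derive. auto. }
unfold dirichlet. induction N as [|N IH]; simpl.
- apply Hj.
- eapply is_RInt_ext; [|apply (is_RInt_plus (V := R_NormedModule) _ _ _ _ _ _ IH (Hj (S N)))].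
  intros t _. unfold plus; simpl. ring.
Qed.

(** * Partial fractions of sech and tanh *)

Lemma cosh_pos (x : R) : 0 < cosh x.
Proof. unfold cosh. generalize (exp_pos x) (exp_pos (- x)). lra. Qed.

(** The test function is 1 at [t = 1], where the cosine vanishes and the sine is [(-1) ^ j]: this
    endpoint supplies the alternating real parts, and the antiderivative is 0 at [t = 0]. *)
Lemma is_series_sech (x : R) :
  is_series (fun j => 2 * (-1) ^ j * cre 1 (freq j) x) (/ cosh x).
Proof.
assert (Hx := cosh_pos x).
assert (H := is_series_cos_coef (fun t => cosh (x * t) / cosh x)
  (fun t => x * sinh (x * t) / cosh x)
  (fun j t => 2 * (x * sinh (x * t) * cos (freq j * t) + freq j * cosh (x * t) * sin (freq j * t))
              / (freq j * freq j + x * x) / cosh x)).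
replace (/ cosh x) with (cosh (x * 0) / cosh x) by (rewrite Rmult_0_r, cosh_0; field; lra).
eapply is_series_ext; [|apply H].
- intros j. simpl. rewrite !Rmult_1_r, !Rmult_0_r, cos_0, sin_0, sinh_0.
  destruct (cos_sin_freq j) as [-> ->].
  rewrite cre_S. unfold cre, cim; simpl. assert (Hj := freq_pos j). field. split; nra.
- intros t. set (c := cosh x) in *. clearbody c. unfold cosh, sinh. auto_derive; [exact I|]. field. lra.
- intros t. apply (ex_derive_continuous (V := R_NormedModule)).
  set (c := cosh x) in *. clearbody c. unfold sinh. auto_derive. exact I.
- intros j t. assert (Hj := freq_pos j). set (a := freq j) in *.
  set (c := cosh x) in *. clearbody c a. unfold cosh, sinh. auto_derive; [exact I|].
  field. split; nra.
Qed.

(** With [1 - t] in place of [t] the test function vanishes at [t = 1], so only [t = 0] contributes.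
    There the cosine is 1 and no alternating sign appears. *)
Lemma is_series_tanh (x : R) :
  is_series (fun j => 2 * cim 1 (freq j) x) (sinh x / cosh x).
Proof.
assert (Hx := cosh_pos x).
assert (H := is_series_cos_coef (fun t => sinh (x * (1 - t)) / cosh x)
  (fun t => - x * cosh (x * (1 - t)) / cosh x)
  (fun j t => 2 * (- x * cosh (x * (1 - t)) * cos (freq j * t)
                   + freq j * sinh (x * (1 - t)) * sin (freq j * t))
              / (freq j * freq j + x * x) / cosh x)).
replace (sinh x / cosh x) with (sinh (x * (1 - 0)) / cosh x)
  by (rewrite Rminus_0_r, Rmult_1_r; reflexivity).
eapply is_series_ext; [|apply H].
- intros j. simpl. rewrite Rminus_diag, Rminus_0_r, !Rmult_1_r, !Rmult_0_r, cos_0, sin_0, sinh_0.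
  destruct (cos_sin_freq j) as [-> ->].
  rewrite cim_S. unfold cre, cim; simpl. assert (Hj := freq_pos j). field. split; nra.
- intros t. set (c := cosh x) in *. clearbody c. unfold cosh, sinh. auto_derive; [exact I|].
  unfold Rminus. field. lra.
- intros t. apply (ex_derive_continuous (V := R_NormedModule)).
  set (c := cosh x) in *. clearbody c. unfold cosh. auto_derive. exact I.
- intros j t. assert (Hj := freq_pos j). set (a := freq j) in *.
  set (c := cosh x) in *. clearbody c a. unfold cosh, sinh. auto_derive; [exact I|].
  unfold Rminus. field. split; nra.
Qed.

(** * Series over the poles of sech and tanh *)

(** Comparison with the telescoping series of [2 / ((j + 1) (j + 2))], using [freq j >= j + 1]. *)
Lemma ex_series_inv_freq (m : nat) : ex_series (fun j => / freq j ^ S (S m)).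
Proof.
apply (ex_series_Rabs_le _ (fun j => 2 * (/ (INR j + 1) - / (INR j + 1 + 1)))).
- intros j. assert (Hj := pos_INR j). assert (Hf := freq_ge j).
  assert (Hp : 0 < freq j ^ S (S m)) by (apply pow_lt; lra).
  rewrite Rabs_right by (apply Rle_ge, Rlt_le, Rinv_0_lt_compat; exact Hp).
  replace (2 * (/ (INR j + 1) - / (INR j + 1 + 1)))
    with (/ ((INR j + 1) * (INR j + 1 + 1) / 2)) by (field; lra).
  apply Rinv_le_contravar; [nra|].
  assert (1 <= freq j ^ m) by (apply pow_R1_Rle; lra).
  simpl. apply Rle_trans with (freq j * freq j); [nra|].
  assert (0 <= freq j * freq j * (freq j ^ m - 1)) by nra. nra.
- apply (ex_series_scal (K := R_AbsRing) (V := R_NormedModule)).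
  exists 1. change (is_lim_seq (sum_n (fun j => / (INR j + 1) - / (INR j + 1 + 1))) 1).
  apply (is_lim_seq_ext (fun n => 1 - / (INR (S n) + 1))).
  + intros n. rewrite sum_n_Reals. induction n as [|n IH].
    * simpl. field.
    * rewrite tech5, <- IH, !S_INR. assert (Hn := pos_INR n). field. lra.
  + apply is_lim_seq_Reals. intros e He.
    destruct (INR_unbounded (/ e)) as [N HN]. exists N. intros n Hn.
    assert (H1 : INR N <= INR n) by (apply le_INR; lia).
    assert (H2 : 0 < / e) by (apply Rinv_0_lt_compat; exact He).
    unfold Rdist. replace (1 - / (INR (S n) + 1) - 1) with (- / (INR (S n) + 1)) by ring.
    rewrite S_INR, Rabs_Ropp, Rabs_right by (apply Rle_ge, Rlt_le, Rinv_0_lt_compat; lra).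
    rewrite <- (Rinv_inv e). apply Rinv_lt_contravar; [nra|lra].
Qed.

Lemma ex_series_2_inv_freq (C : R) (m : nat) :
  ex_series (fun j => C * / freq j ^ S (S m)).
Proof.
apply (ex_series_scal (K := R_AbsRing) (V := R_NormedModule)), ex_series_inv_freq.
Qed.

(** The companion of [ser_im s m], which is the [B_m] of the overview; differentiation exchanges the
    two and raises [m] by one. *)
Definition ser_re (s : R) (m : nat) (x : R) : R :=
  Series (fun j => 2 * s ^ j * cre m (freq j) x).
Definition ser_im (s : R) (m : nat) (x : R) : R :=
  Series (fun j => 2 * s ^ j * cim m (freq j) x).

Lemma pow_abs_le_1 (s : R) (j : nat) : Rabs s <= 1 -> Rabs (s ^ j) <= 1.
Proof.
intros Hs. rewrite <- RPow_abs. rewrite <- (pow1 j). apply pow_incr.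
split; [apply Rabs_pos|exact Hs].
Qed.

Lemma scaled_term_le (s c B : R) (j : nat) :
  Rabs s <= 1 -> Rabs c <= B -> Rabs (2 * s ^ j * c) <= 2 * B.
Proof.
intros Hs Hc. rewrite !Rabs_mult, (Rabs_right 2) by lra.
assert (H := pow_abs_le_1 s j Hs).
generalize (Rabs_pos (s ^ j)) (Rabs_pos c). nra.
Qed.

Lemma ex_series_cre_cim (s : R) (m : nat) (x : R) : Rabs s <= 1 ->
  ex_series (fun j => 2 * s ^ j * cre (S (S m)) (freq j) x) /\
  ex_series (fun j => 2 * s ^ j * cim (S (S m)) (freq j) x).
Proof.
intros Hs. split; (eapply ex_series_Rabs_le; [|apply (ex_series_2_inv_freq 2 m)]);
  intros j; apply scaled_term_le; try exact Hs; apply cre_cim_le, freq_pos.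
Qed.

(** The differentiated terms have order at least 2 and are dominated even for [m = 0]. Convergence
    of the original series is a hypothesis so that the conditionally convergent sech series is
    covered. *)
Lemma is_derive_ser_re (s : R) (m : nat) (x : R) : Rabs s <= 1 ->
  (forall y, ex_series (fun j => 2 * s ^ j * cre (S m) (freq j) y)) ->
  is_derive (ser_re s (S m)) x (- INR (S m) * ser_im s (S (S m)) x).
Proof.
intros Hs Hex. unfold ser_im. rewrite <- Series_scal_l.
apply (is_derive_Series (fun j y => 2 * s ^ j * cre (S m) (freq j) y)
   (fun j y => - INR (S m) * (2 * s ^ j * cim (S (S m)) (freq j) y))
   (fun j => (INR (S m) * 2) * / freq j ^ S (S m)) x (mkposreal 1 Rlt_0_1)).
- apply ex_series_2_inv_freq.
- intros j y _. destruct (is_derive_cre_cim (S m) (freq j) y (freq_pos j)) as [H _].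
  replace (- INR (S m) * (2 * s ^ j * cim (S (S m)) (freq j) y))
    with (2 * s ^ j * (- INR (S m) * cim (S (S m)) (freq j) y)) by ring.
  apply is_derive_scal, H.
- intros j y _. rewrite Rabs_mult, Rabs_Ropp, (Rabs_right (INR (S m)))
    by (apply Rle_ge, pos_INR).
  rewrite (Rmult_assoc (INR (S m))). apply Rmult_le_compat_l; [apply pos_INR|].
  apply scaled_term_le; [exact Hs|]. apply cre_cim_le, freq_pos.
- intros y _. apply Hex.
Qed.

Lemma is_derive_ser_im (s : R) (m : nat) (x : R) : Rabs s <= 1 ->
  (forall y, ex_series (fun j => 2 * s ^ j * cim (S m) (freq j) y)) ->
  is_derive (ser_im s (S m)) x (INR (S m) * ser_re s (S (S m)) x).
Proof.
intros Hs Hex. unfold ser_re. rewrite <- Series_scal_l.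
apply (is_derive_Series (fun j y => 2 * s ^ j * cim (S m) (freq j) y)
   (fun j y => INR (S m) * (2 * s ^ j * cre (S (S m)) (freq j) y))
   (fun j => (INR (S m) * 2) * / freq j ^ S (S m)) x (mkposreal 1 Rlt_0_1)).
- apply ex_series_2_inv_freq.
- intros j y _. destruct (is_derive_cre_cim (S m) (freq j) y (freq_pos j)) as [_ H].
  replace (INR (S m) * (2 * s ^ j * cre (S (S m)) (freq j) y))
    with (2 * s ^ j * (INR (S m) * cre (S (S m)) (freq j) y)) by ring.
  apply is_derive_scal, H.
- intros j y _. rewrite Rabs_mult, (Rabs_right (INR (S m))) by (apply Rle_ge, pos_INR).
  rewrite (Rmult_assoc (INR (S m))). apply Rmult_le_compat_l; [apply pos_INR|].
  apply scaled_term_le; [exact Hs|]. apply cre_cim_le, freq_pos.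
- intros y _. apply Hex.
Qed.

(** * Derivatives of powers of sech *)

Lemma is_derive_sinh (x : R) : is_derive sinh x (cosh x).
Proof. apply is_derive_Reals, derivable_pt_lim_sinh. Qed.

Lemma sinh_sqr (x : R) : sinh x * sinh x = cosh x * cosh x - 1.
Proof.
unfold sinh, cosh. rewrite exp_Ropp. field. generalize (exp_pos x). lra.
Qed.

Lemma is_derive_inv_cosh_pow (m : nat) (x : R) :
  is_derive (fun t => / cosh t ^ m) x (- INR m * (sinh x / cosh x ^ S m)).
Proof.
assert (Hx := cosh_pos x).
assert (Hp : cosh x ^ m <> 0) by (apply pow_nonzero; lra).
auto_derive; [auto|].
destruct m as [|m].
- simpl. field. lra.
- simpl pred. assert (Hm : cosh x ^ m <> 0) by (apply pow_nonzero; lra).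
  simpl pow. field. lra.
Qed.

Lemma is_derive_sinh_div_cosh_pow (m : nat) (x : R) :
  is_derive (fun t => sinh t / cosh t ^ S m) x
    (INR (S m) / cosh x ^ S (S m) - INR m / cosh x ^ m).
Proof.
assert (Hx := cosh_pos x). assert (Hp : cosh x ^ m <> 0) by (apply pow_nonzero; lra).
assert (H1 := is_derive_inv_cosh_pow (S m) x). assert (H2 := is_derive_sinh x).
assert (H := is_derive_mult _ _ x _ _ H2 H1 Rmult_comm).
unfold plus, mult in H; simpl in H.
replace (INR (S m) / cosh x ^ S (S m) - INR m / cosh x ^ m) with
  (cosh x * / (cosh x * cosh x ^ m) +
   sinh x * (- (match m with 0%nat => 1 | S _ => INR m + 1 end) *
   (sinh x / (cosh x * (cosh x * cosh x ^ m))))).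
- exact H.
- change (match m with 0%nat => 1 | S _ => INR m + 1 end) with (INR (S m)).
  rewrite S_INR. simpl pow.
  replace (sinh x * (- (INR m + 1) * (sinh x / (cosh x * (cosh x * cosh x ^ m))))) with
    (- (INR m + 1) * (sinh x * sinh x / (cosh x * (cosh x * cosh x ^ m)))) by (field; lra).
  rewrite sinh_sqr. field. lra.
Qed.

Lemma is_derive2_sinh_div_cosh_pow (m : nat) (x : R) :
  is_derive (fun t => INR (S m) / cosh t ^ S (S m) - INR m / cosh t ^ m) x
    (INR m * INR m * (sinh x / cosh x ^ S m)
     - INR (S m) * INR (S (S m)) * (sinh x / cosh x ^ S (S (S m)))).
Proof.
assert (H : is_derive (fun t => INR (S m) / cosh t ^ S (S m) - INR m / cosh t ^ m) x
  (INR (S m) * (- INR (S (S m)) * (sinh x / cosh x ^ S (S (S m))))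
   - INR m * (- INR m * (sinh x / cosh x ^ S m)))).
{ exact (is_derive_minus (V := R_NormedModule) _ _ x _ _
    (is_derive_scal _ x (INR (S m)) _ (is_derive_inv_cosh_pow (S (S m)) x))
    (is_derive_scal _ x (INR m) _ (is_derive_inv_cosh_pow m x))). }
match type of H with is_derive _ _ ?l =>
  match goal with |- is_derive _ _ ?r => replace r with l by ring end end.
exact H.
Qed.

(** For [eps = 0] sech is differentiated once; for [eps = 1] tanh is differentiated twice, passing
    through [ser_re 1 2]. *)
Lemma sinh_div_cosh_pow_base (eps : nat) (x : R) : eps = 0%nat \/ eps = 1%nat ->
  sinh x / cosh x ^ (2 + eps) = ser_im (2 * INR eps - 1) (2 + eps) x.
Proof.
intros [-> | ->].
- replace (2 * INR 0 - 1) with (-1) by (simpl; ring).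
  assert (Ha : Rabs (-1) <= 1) by (apply Rabs_le_between; lra).
  assert (H := is_derive_ser_re (-1) 0 x Ha (fun y => ex_intro _ _ (is_series_sech y))).
  assert (H1 := is_derive_inv_cosh_pow 1 x).
  apply (is_derive_ext _ (ser_re (-1) 1)) in H1.
  2: { intros t. unfold ser_re. symmetry. rewrite pow_1. apply is_series_unique, is_series_sech. }
  apply is_derive_unique in H. apply is_derive_unique in H1. rewrite H in H1.
  simpl INR in H1. change (2 + 0)%nat with 2%nat. lra.
- replace (2 * INR 1 - 1) with 1 by (simpl; ring).
  assert (Ha : Rabs 1 <= 1) by (rewrite Rabs_R1; lra).
  assert (Hs : forall y, is_series (fun j => 2 * 1 ^ j * cim 1 (freq j) y) (sinh y / cosh y)).
  { intros y. eapply is_series_ext; [|apply is_series_tanh].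
    intros j. cbv beta. rewrite pow1, Rmult_1_r. reflexivity. }
  (* The zero term is kept so that the left side is the function differentiated in
     [is_derive2_sinh_div_cosh_pow 0]. *)
  assert (H : forall y, 1 / cosh y ^ 2 - 0 / cosh y ^ 0 = ser_re 1 2 y).
  { intros y.
    assert (H := is_derive_ser_im 1 0 y Ha (fun y => ex_intro _ _ (Hs y))).
    assert (H1 := is_derive_sinh_div_cosh_pow 0 y).
    apply (is_derive_ext _ (ser_im 1 1)) in H1.
    2: { intros t. unfold ser_im. symmetry. rewrite pow_1. apply is_series_unique, Hs. }
    apply is_derive_unique in H. apply is_derive_unique in H1. rewrite H in H1.
    simpl INR in H1. lra. }
  assert (H1 := is_derive2_sinh_div_cosh_pow 0 x).
  apply (is_derive_ext _ (ser_re 1 2) _ _ H) in H1.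
  assert (H2 := is_derive_ser_re 1 1 x Ha (fun y => proj1 (ex_series_cre_cim 1 0 y Ha))).
  apply is_derive_unique in H1. apply is_derive_unique in H2. rewrite H2 in H1.
  simpl INR in H1. change (2 + 1)%nat with 3%nat. lra.
Qed.

(** * Taylor coefficients of powers of arcsin *)

(* [asin_coef M q] is the coefficient of [z ^ M] in [asin z ^ q]; the recursion is
   the equation [(1 - z^2) y'' - z y' = q (q - 1) asin z ^ (q - 2)] for [y = asin z ^ q].
   When [q < 2] the truncated [q - 2] is harmless because of the factor [q (q - 1)]. *)
Fixpoint asin_coef (M q : nat) : R :=
  match M with
  | O => if Nat.eqb q 0 then 1 else 0
  | S M1 =>
      match M1 with
      | O => if Nat.eqb q 1 then 1 else 0
      | S M2 => (INR M2 * INR M2 * asin_coef M2 q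
                 + INR q * (INR q - 1) * asin_coef M2 (q - 2)) / (INR M1 * INR M)
      end
  end.

Lemma asin_coef_SS (M q : nat) :
  INR (S M) * INR (S (S M)) * asin_coef (S (S M)) q =
  INR M * INR M * asin_coef M q + INR q * (INR q - 1) * asin_coef M (q - 2).
Proof.
change (asin_coef (S (S M)) q) with
  ((INR M * INR M * asin_coef M q + INR q * (INR q - 1) * asin_coef M (q - 2))
   / (INR (S M) * INR (S (S M)))).
field. split; apply not_0_INR; lia.
Qed.

Lemma nat_pair_ind (P : nat -> Prop) :
  P 0%nat -> P 1%nat -> (forall n, P n -> P (S n) -> P (S (S n))) -> forall n, P n.
Proof.
intros H0 H1 HS n. enough (P n /\ P (S n)) by tauto.
induction n as [|n [IH1 IH2]]; auto.
Qed.

Lemma asin_coef_eq (M q : nat) (r : R) :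
  INR M * INR M * asin_coef M q + INR q * (INR q - 1) * asin_coef M (q - 2) =
  INR (S M) * INR (S (S M)) * r -> asin_coef (S (S M)) q = r.
Proof.
rewrite <- asin_coef_SS. intros H. apply Rmult_eq_reg_l in H; [exact H|].
apply Rmult_integral_contrapositive_currified; apply not_0_INR; lia.
Qed.

(** The power [asin z ^ q] vanishes to order [q] at 0; this is what makes the expansions finite. *)
Lemma asin_coef_lt (M q : nat) : (M < q)%nat -> asin_coef M q = 0.
Proof.
revert q. pattern M. apply nat_pair_ind; clear M.
- intros [|q] H; [lia|reflexivity].
- intros [|[|q]] H; [lia|lia|reflexivity].
- intros M IH _ q H. apply asin_coef_eq. rewrite !IH by lia. ring.
Qed.

Lemma asin_coef_0_r (M : nat) : asin_coef (S M) 0 = 0.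
Proof.
pattern M. apply nat_pair_ind; clear M.
- reflexivity.
- apply asin_coef_eq. simpl. ring.
- intros M IH _. apply asin_coef_eq. rewrite IH. simpl INR at 3. ring.
Qed.

(** * Expansion of sinh over powers of cosh *)

Lemma sum_shift (g h : nat -> R) (N : nat) :
  g 0%nat = 0 -> (forall p, g (S p) = h p) ->
  sum_f_R0 h N = sum_f_R0 g N + h N.
Proof.
intros H0 HS. induction N as [|N IH]; simpl; [lra|]. rewrite IH, HS. ring.
Qed.

Lemma is_derive_sum_f (f : nat -> R -> R) (d : nat -> R) (N : nat) (x : R) :
  (forall p, is_derive (f p) x (d p)) ->
  is_derive (fun t => sum_f_R0 (fun p => f p t) N) x (sum_f_R0 d N).
Proof.
intros H. induction N as [|N IH]; simpl; [apply H|].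
apply (is_derive_plus (V := R_NormedModule) _ _ _ _ _ IH (H (S N))).
Qed.

(** The range of summation is a fixed [N >= n], the excess terms being zero by [asin_coef_lt];
    expansions for different [n] can then be combined term by term. The induction on [n] is uniform
    in [x], because its hypothesis is differentiated twice. *)
Lemma expansion_0 (eps N n : nat) (x : R) : eps = 0%nat \/ eps = 1%nat ->
  (n <= N)%nat ->
  sinh x / cosh x ^ (S (2 * n + 1 + eps)) =
  sum_f_R0 (fun p => asin_coef (2 * n + 1 + eps) (2 * p + 1 + eps)
    * ser_im (2 * INR eps - 1) (S (2 * p + 1 + eps)) x) N.
Proof.
intros Heps Hn. set (s := 2 * INR eps - 1).
assert (Hs : Rabs s <= 1).
{ unfold s. destruct Heps as [-> | ->]; simpl; apply Rabs_le_between; lra. }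
revert x. induction n as [|n IH]; intros x.
- replace (S (2 * 0 + 1 + eps)) with (2 + eps)%nat by lia.
  rewrite sinh_div_cosh_pow_base by exact Heps. fold s.
  assert (H1 : asin_coef (2 * 0 + 1 + eps) (2 * 0 + 1 + eps) = 1)
    by (destruct Heps as [-> | ->]; simpl; field).
  clear Hn. induction N as [|N IH].
  + cbn [sum_f_R0]. rewrite H1. rewrite Rmult_1_l. reflexivity.
  + rewrite tech5, <- IH, asin_coef_lt by lia. ring.
- specialize (IH ltac:(lia)).
  set (M := (2 * n + 1 + eps)%nat) in *.
  set (q := fun p => (2 * p + 1 + eps)%nat).
  replace (2 * S n + 1 + eps)%nat with (S (S M)) by (unfold M; lia).
  assert (Hex : forall m y, ex_series (fun j => 2 * s ^ j * cre (S (S m)) (freq j) y) /\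
                            ex_series (fun j => 2 * s ^ j * cim (S (S m)) (freq j) y))
    by (intros; apply ex_series_cre_cim, Hs).
  assert (Hq : forall p, exists m, q p = S m) by (intros p; exists (2 * p + eps)%nat; unfold q; lia).
  assert (H1 : forall y, INR (S M) / cosh y ^ S (S M) - INR M / cosh y ^ M =
    sum_f_R0 (fun p => asin_coef M (q p) * (INR (S (q p)) * ser_re s (S (S (q p))) y)) N).
  { intros y.
    assert (Ha := is_derive_sinh_div_cosh_pow M y).
    apply (is_derive_ext _ _ _ _ IH) in Ha.
    assert (Hb : forall p, is_derive (fun t => asin_coef M (q p) * ser_im s (S (q p)) t) y
       (asin_coef M (q p) * (INR (S (q p)) * ser_re s (S (S (q p))) y))).
    { intros p. apply is_derive_scal. destruct (Hq p) as [m ->].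
      apply is_derive_ser_im; [exact Hs|]. intros z. apply Hex. }
    apply (is_derive_sum_f _ _ N) in Hb. apply is_derive_unique in Ha.
    apply is_derive_unique in Hb. rewrite <- Ha. exact Hb. }
  assert (H2 : INR M * INR M * (sinh x / cosh x ^ S M)
     - INR (S M) * INR (S (S M)) * (sinh x / cosh x ^ S (S (S M))) =
    sum_f_R0 (fun p => asin_coef M (q p) * (INR (S (q p)) *
       (- INR (S (S (q p))) * ser_im s (S (S (S (q p)))) x))) N).
  { assert (Ha := is_derive2_sinh_div_cosh_pow M x).
    apply (is_derive_ext _ _ _ _ H1) in Ha.
    assert (Hb : forall p, is_derive
       (fun t => asin_coef M (q p) * (INR (S (q p)) * ser_re s (S (S (q p))) t)) x
       (asin_coef M (q p) * (INR (S (q p)) *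
       (- INR (S (S (q p))) * ser_im s (S (S (S (q p)))) x)))).
    { intros p. apply is_derive_scal, is_derive_scal. destruct (Hq p) as [m ->].
      apply is_derive_ser_re; [exact Hs|]. intros z. apply Hex. }
    apply (is_derive_sum_f _ _ N) in Hb. apply is_derive_unique in Ha.
    apply is_derive_unique in Hb. rewrite <- Ha. exact Hb. }
  assert (HM : INR (S M) * INR (S (S M)) <> 0)
    by (apply Rmult_integral_contrapositive_currified; apply not_0_INR; lia).
  apply (Rmult_eq_reg_l (INR (S M) * INR (S (S M)))); [|exact HM].
  rewrite scal_sum.
  (* Two derivatives raise the order from [S (q p)] to [S (q (S p))]. Reindexing turns them into the
     [q (q - 1)] term of the recurrence for [asin_coef]. *)
  assert (H3 := sum_shift
    (fun p => INR (q p) * (INR (q p) - 1) * asin_coef M (q p - 2) * ser_im s (S (q p)) x)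
    (fun p => asin_coef M (q p) * (INR (S (q p)) * (INR (S (S (q p))) * ser_im s (S (S (S (q p)))) x)))
    N).
  (* The term left over by the shift vanishes, since [n < N] gives [M < q N]. *)
  cbv beta in H3. rewrite (asin_coef_lt M (q N)) in H3 by (unfold M, q; lia).
  rewrite Rmult_0_l, Rplus_0_r in H3.
  rewrite (sum_eq _ (fun p => (asin_coef M (q p) * ser_im s (S (q p)) x) * (INR M * INR M) +
    INR (q p) * (INR (q p) - 1) * asin_coef M (q p - 2) * ser_im s (S (q p)) x)).
  + rewrite plus_sum, <- scal_sum, <- H3.
    * unfold q, M in IH. rewrite <- IH. fold M.
      assert (H4 : forall N, sum_f_R0 (fun p => asin_coef M (q p) * (INR (S (q p)) *
       (- INR (S (S (q p))) * ser_im s (S (S (S (q p)))) x))) N =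
       - sum_f_R0 (fun p => asin_coef M (q p) * (INR (S (q p)) *
        (INR (S (S (q p))) * ser_im s (S (S (S (q p)))) x))) N).
      { clear. intros N. induction N as [|N IH]; cbn [sum_f_R0]; [|rewrite IH]; ring. }
      rewrite H4 in H2. lra.
    (* The term at [p = 0] vanishes: for [eps = 0] by the factor [q 0 - 1], for [eps = 1] because
       [asin z ^ 0] has no coefficient in positive degree. *)
    * unfold q, M. destruct Heps as [-> | ->]; simpl INR; [ring|].
      replace (2 * 0 + 1 + 1 - 2)%nat with 0%nat by lia.
      replace (2 * n + 1 + 1)%nat with (S (2 * n + 1)) by lia.
      rewrite asin_coef_0_r. ring.
    * intros p. replace (q (S p)) with (S (S (q p))) by (unfold q; lia).
      replace (S (S (q p)) - 2)%nat with (q p) by lia. rewrite !S_INR. ring.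
  + intros p _. change (2 * p + 1 + eps)%nat with (q p).
    transitivity (INR (S M) * INR (S (S M)) * asin_coef (S (S M)) (q p) * ser_im s (S (q p)) x);
      [ring|].
    rewrite asin_coef_SS. ring.
Qed.

(** * The power series of arcsin^q *)

(** The factor [q (q - 1)] carries [(q - 2)!] to [q!], and [M^2 + 1 <= (M + 1) (M + 2)] keeps the
    bound uniform in [M]. Hence the radius of convergence is at least 1. *)
Lemma asin_coef_le (M q : nat) : Rabs (asin_coef M q) <= INR (fact q).
Proof.
assert (Hf : forall q, 1 <= INR (fact q)).
{ intros p. apply (le_INR 1). generalize (lt_O_fact p). lia. }
revert q. pattern M. apply nat_pair_ind; clear M.
- intros q. simpl. destruct (Nat.eqb q 0); rewrite ?Rabs_R1, ?Rabs_R0; generalize (Hf q); lra.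
- intros q. simpl. destruct (Nat.eqb q 1); rewrite ?Rabs_R1, ?Rabs_R0; generalize (Hf q); lra.
- intros M IH _ q.
  assert (HM := pos_INR M).
  assert (Hq : Rabs (INR q * (INR q - 1) * asin_coef M (q - 2)) <= INR (fact q)).
  { destruct q as [|[|q]].
    - simpl. rewrite !Rmult_0_l, Rabs_R0. lra.
    - simpl. rewrite Rminus_diag, Rmult_0_r, Rmult_0_l, Rabs_R0. lra.
    - replace (S (S q) - 2)%nat with q by lia.
      replace (fact (S (S q))) with (S (S q) * (S q * fact q))%nat by reflexivity.
      rewrite !mult_INR. replace (INR (S (S q)) - 1) with (INR (S q)) by (rewrite (S_INR (S q)); ring).
      rewrite Rabs_mult, (Rabs_right (INR (S (S q)) * INR (S q))), <- Rmult_assoc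
        by (apply Rle_ge, Rmult_le_pos; apply pos_INR).
      apply Rmult_le_compat_l; [apply Rmult_le_pos; apply pos_INR|apply IH]. }
  assert (H := asin_coef_SS M q). rewrite !S_INR in H.
  specialize (IH q). specialize (Hf q).
  assert (H1 : (INR M + 1) * (INR M + 1 + 1) * Rabs (asin_coef (S (S M)) q) <=
               INR M * INR M * INR (fact q) + INR (fact q)).
  { rewrite <- (Rabs_right ((INR M + 1) * (INR M + 1 + 1))) at 1 by nra.
    rewrite <- Rabs_mult, H. eapply Rle_trans; [apply Rabs_triang|].
    apply Rplus_le_compat; [|exact Hq].
    rewrite Rabs_mult, (Rabs_right (INR M * INR M)) by nra.
    apply Rmult_le_compat_l; [nra|exact IH]. }
  apply (Rmult_le_reg_l ((INR M + 1) * (INR M + 1 + 1))); [nra|]. nra.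
Qed.

Lemma CV_radius_gt (a : nat -> R) (K z : R) :
  (forall n, Rabs (a n) <= K) -> Rabs z < 1 -> Rbar_lt (Rabs z) (CV_radius a).
Proof.
intros Ha Hz. apply Rbar_lt_le_trans with 1; [exact Hz|].
apply (CV_radius_bounded a). exists K. intros n. rewrite pow1, Rmult_1_r. apply Ha.
Qed.

Lemma is_derive_asin (z : R) : Rabs z < 1 -> is_derive asin z (/ sqrt (1 - z * z)).
Proof.
intros Hz. apply Rabs_def2 in Hz. assert (H : -1 < z < 1) by lra.
apply is_derive_Reals. rewrite <- Rdiv_1_l.
apply (derive_pt_eq_1 _ _ _ (derivable_pt_asin z H)), derive_pt_asin.
Qed.

Lemma is_derive_asin_pow (q : nat) (z : R) : Rabs z < 1 ->
  is_derive (fun t => asin t ^ q) z (INR q * asin z ^ (q - 1) / sqrt (1 - z * z)).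
Proof.
intros Hz. replace (q - 1)%nat with (pred q) by lia.
replace (INR q * asin z ^ pred q / sqrt (1 - z * z))
  with (INR q * (/ sqrt (1 - z * z)) * asin z ^ pred q) by (unfold Rdiv; ring).
apply is_derive_pow, is_derive_asin, Hz.
Qed.

Lemma zero_derive_const (f : R -> R) (z : R) :
  (forall t, Rabs t < 1 -> is_derive f t 0) -> Rabs z < 1 -> f z = f 0.
Proof.
intros H Hz. apply Rabs_def2 in Hz.
assert (Hin : forall c, Rmin 0 z <= c <= Rmax 0 z -> Rabs c < 1).
{ intros c Hc. unfold Rmin, Rmax in Hc. apply Rabs_def1; destruct (Rle_dec 0 z); lra. }
destruct (MVT_gen f 0 z (fun _ => 0)) as [c [_ E]].
- intros t Ht. apply H, Hin. lra.
- intros t Ht. apply derivable_continuous_pt, ex_derive_Reals_0. eexists. apply H, Hin, Ht.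
- lra.
Qed.

(* Both sides make [sqrt (1 - z^2) y'] an antiderivative of the same function. *)
Lemma asin_pow_ode (f f1 f2 : R -> R) (q : nat) (z : R) :
  (forall t, Rabs t < 1 -> is_derive f t (f1 t)) ->
  (forall t, Rabs t < 1 -> is_derive f1 t (f2 t)) ->
  (forall t, Rabs t < 1 ->
     (1 - t * t) * f2 t - t * f1 t = INR q * (INR q - 1) * asin t ^ (q - 2)) ->
  f 0 = 0 ^ q -> f1 0 = INR q * 0 ^ (q - 1) -> Rabs z < 1 -> f z = asin z ^ q.
Proof.
intros Hf Hf1 Hode H0 H1 Hz.
assert (Hsq : forall t, Rabs t < 1 -> 0 < 1 - t * t).
{ intros t Ht. apply Rabs_def2 in Ht. nra. }
assert (Hw : forall t, Rabs t < 1 -> f1 t = INR q * asin t ^ (q - 1) / sqrt (1 - t * t)).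
{ intros t Ht.
  assert (H : sqrt (1 - t * t) * f1 t - INR q * asin t ^ (q - 1) =
              sqrt (1 - 0 * 0) * f1 0 - INR q * asin 0 ^ (q - 1)).
  { apply (zero_derive_const (fun t => sqrt (1 - t * t) * f1 t - INR q * asin t ^ (q - 1)));
      [|exact Ht].
    clear t Ht. intros t Ht. specialize (Hsq t Ht). specialize (Hf1 t Ht).
    assert (Hs : 0 < sqrt (1 - t * t)) by (apply sqrt_lt_R0; exact Hsq).
    assert (Hss : sqrt (1 - t * t) * sqrt (1 - t * t) = 1 - t * t) by (apply sqrt_sqrt; lra).
    set (g := fun t => asin t ^ (q - 1)).
    assert (Ha : is_derive g t _) by exact (is_derive_asin_pow (q - 1) t Ht).
    assert (E1 : ex_derive f1 t) by (eexists; exact Hf1).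
    assert (E2 : ex_derive g t) by (eexists; exact Ha).
    apply is_derive_unique in Hf1. apply is_derive_unique in Ha.
    change (is_derive (fun t => sqrt (1 - t * t) * f1 t - INR q * g t) t 0).
    clearbody g. auto_derive; [repeat split; auto; lra|].
    change (Derive (fun t => f1 t) t) with (Derive f1 t).
    change (Derive (fun t => g t) t) with (Derive g t).
    rewrite Hf1, Ha. specialize (Hode t Ht).
    replace (q - 1 - 1)%nat with (q - 2)%nat by lia.
    (* The truncated subtraction at [q = 0] is absorbed by the factor [INR q]. *)
    assert (Hq : INR q * INR (q - 1) = INR q * (INR q - 1)).
    { destruct q as [|q]; [simpl; ring|]. replace (S q - 1)%nat with q by lia.
      rewrite S_INR. ring. }
    change (1 + - (t * t)) with (1 - t * t).
    apply (Rmult_eq_reg_r (sqrt (1 - t * t))); [|lra].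
    transitivity (sqrt (1 - t * t) * sqrt (1 - t * t) * f2 t - t * f1 t
      - INR q * INR (q - 1) * asin t ^ (q - 2)); [field; lra|].
    rewrite Hss, Hq. lra. }
  rewrite asin_0, H1, Rmult_0_l, Rminus_0_r, sqrt_1 in H.
  assert (Hs : 0 < sqrt (1 - t * t)) by (apply sqrt_lt_R0, Hsq, Ht).
  apply (Rmult_eq_reg_r (sqrt (1 - t * t))); [|lra].
  unfold Rdiv. rewrite Rmult_assoc, Rinv_l by lra. lra. }
assert (H : f z - asin z ^ q = f 0 - asin 0 ^ q).
{ apply (zero_derive_const (fun t => f t - asin t ^ q)); [|exact Hz].
  intros t Ht. replace 0 with (f1 t - INR q * asin t ^ (q - 1) / sqrt (1 - t * t))
    by (rewrite Hw by exact Ht; ring).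
  apply (is_derive_minus (V := R_NormedModule)); [apply Hf, Ht|apply is_derive_asin_pow, Ht]. }
rewrite asin_0, H0 in H. lra.
Qed.

(** The weight [M^2] in the recurrence is the square of the Euler operator [z d/dz]. With [b] the
    coefficients of [z y'], the recurrence reads [y'' = z (z y')' + q (q - 1) asin^(q - 2)], and
    [(z y')' = y' + z y'']. *)
Lemma asin_coef_ode (q : nat) (z : R) : Rabs z < 1 ->
  let a := fun M => asin_coef M q in
  (1 - z * z) * PSeries (PS_derive (PS_derive a)) z - z * PSeries (PS_derive a) z =
  INR q * (INR q - 1) * PSeries (fun M => asin_coef M (q - 2)) z.
Proof.
intros Hz a.
assert (Ha : Rbar_lt (Rabs z) (CV_radius a)) by (apply (CV_radius_gt _ _ _ (fun M => asin_coef_le M q) Hz)).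
set (b := PS_incr_1 (PS_derive a)).
assert (Hb : Rbar_lt (Rabs z) (CV_radius b))
  by (unfold b; rewrite CV_radius_incr_1, CV_radius_derive; exact Ha).
assert (Hd : PSeries (PS_derive b) z = PSeries (PS_derive a) z + z * PSeries (PS_derive (PS_derive a)) z).
{ rewrite <- Derive_PSeries by exact Hb.
  rewrite (Derive_ext _ (fun t => t * PSeries (PS_derive a) t)).
  2: { intros t. apply PSeries_incr_1. }
  assert (H2 : is_derive (PSeries (PS_derive a)) z (PSeries (PS_derive (PS_derive a)) z)).
  { apply is_derive_PSeries. rewrite CV_radius_derive. exact Ha. }
  apply is_derive_unique.
  replace (PSeries (PS_derive a) z + z * PSeries (PS_derive (PS_derive a)) z) with
    (1 * PSeries (PS_derive a) z + z * PSeries (PS_derive (PS_derive a)) z) by ring.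
  apply (is_derive_mult (fun t => t) (PSeries (PS_derive a)) z 1 _ (is_derive_id z) H2 Rmult_comm). }
assert (He : PSeries (PS_derive (PS_derive a)) z =
  PSeries (PS_plus (PS_incr_1 (PS_derive b))
    (PS_scal (INR q * (INR q - 1)) (fun M => asin_coef M (q - 2)))) z).
{ apply PSeries_ext. intros M. unfold PS_plus, PS_scal, PS_derive, plus, scal; simpl plus.
  unfold mult; simpl mult. unfold a.
  transitivity (INR (S M) * INR (S (S M)) * asin_coef (S (S M)) q); [ring|].
  rewrite asin_coef_SS.
  replace (PS_incr_1 (fun n => INR (S n) * b (S n)) M) with (INR M * INR M * asin_coef M q);
    [reflexivity|].
  destruct M as [|M]; [unfold PS_incr_1; simpl; unfold zero; simpl; ring|].
  change (INR (S M) * INR (S M) * asin_coef (S M) q =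
          INR (S M) * (INR (S M) * asin_coef (S M) q)). ring. }
rewrite PSeries_plus, PSeries_scal, PSeries_incr_1, Hd in He.
- rewrite He at 1. nra.
- apply CV_radius_inside. rewrite CV_radius_incr_1, CV_radius_derive. exact Hb.
- apply CV_radius_inside.
  apply (CV_radius_gt _ (Rabs (INR q * (INR q - 1)) * INR (fact (q - 2)))); [|exact Hz].
  intros M. unfold PS_scal, scal; simpl; unfold mult; simpl. rewrite Rabs_mult.
  apply Rmult_le_compat_l; [apply Rabs_pos|apply asin_coef_le].
Qed.

(** Induction in steps of two, as the equation for [q] has the power [q - 2] on its right side; for
    [q < 2] that side is zero. *)
Lemma asin_pow_PSeries (q : nat) (z : R) : Rabs z < 1 ->
  asin z ^ q = PSeries (fun M => asin_coef M q) z.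
Proof.
assert (Hgen : forall q, (forall t, Rabs t < 1 ->
   INR q * (INR q - 1) * PSeries (fun M => asin_coef M (q - 2)) t =
   INR q * (INR q - 1) * asin t ^ (q - 2)) ->
  forall t, Rabs t < 1 -> asin t ^ q = PSeries (fun M => asin_coef M q) t).
{ clear. intros q Hq t Ht. symmetry.
  set (a := fun M => asin_coef M q).
  assert (Ha : forall t, Rabs t < 1 -> Rbar_lt (Rabs t) (CV_radius a))
    by (intros; apply (CV_radius_gt _ _ _ (fun M => asin_coef_le M q)); assumption).
  apply (asin_pow_ode _ (PSeries (PS_derive a)) (PSeries (PS_derive (PS_derive a)))).
  - intros u Hu. apply is_derive_PSeries, Ha, Hu.
  - intros u Hu. apply is_derive_PSeries. rewrite CV_radius_derive. apply Ha, Hu.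
  - intros u Hu. rewrite <- Hq by exact Hu. apply (asin_coef_ode q u Hu).
  - rewrite PSeries_0. unfold a. destruct q; simpl; ring.
  - rewrite PSeries_0. unfold PS_derive, a. destruct q as [|[|q]]; simpl; ring.
  - exact Ht. }
revert z. pattern q. apply nat_pair_ind; clear q.
- apply Hgen. intros t _. simpl. ring.
- apply Hgen. intros t _. simpl. ring.
- intros q IH _. apply Hgen. intros t Ht. replace (S (S q) - 2)%nat with q by lia.
  rewrite IH by exact Ht. reflexivity.
Qed.

(** * Multiplication by Chebyshev polynomials *)

(** Coefficients of [U_m(z)] times the series of [c]. Since [chebyshev_U] is a function and has no
    coefficient list, its recurrence is replayed on sequences, [PS_incr_1] being multiplication by
    [z]. *)
Fixpoint cheb_coef (m : nat) (c : nat -> R) (r : nat) : R :=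
  match m with
  | O => c r
  | S m1 =>
      match m1 with
      | O => 2 * PS_incr_1 c r
      | S m2 => 2 * PS_incr_1 (cheb_coef m1 c) r - cheb_coef m2 c r
      end
  end.

Lemma PS_incr_1_le (c : nat -> R) (K : R) :
  (forall r, Rabs (c r) <= K) -> forall r, Rabs (PS_incr_1 c r) <= K.
Proof.
intros H [|r]; [|apply H]. simpl. unfold zero; simpl. rewrite Rabs_R0.
eapply Rle_trans; [apply Rabs_pos|apply (H 0%nat)].
Qed.

Lemma cheb_coef_bounded (m : nat) (c : nat -> R) (K : R) :
  (forall r, Rabs (c r) <= K) -> exists K', forall r, Rabs (cheb_coef m c r) <= K'.
Proof.
intros Hc. pattern m. apply nat_pair_ind; clear m.
- exists K. exact Hc.
- exists (2 * K). intros r. simpl. rewrite Rabs_mult, (Rabs_right 2) by lra.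
  generalize (PS_incr_1_le c K Hc r). lra.
- intros m [K0 H0] [K1 H1]. exists (2 * K1 + K0). intros r.
  change (cheb_coef (S (S m)) c r) with
    (2 * PS_incr_1 (cheb_coef (S m) c) r - cheb_coef m c r).
  eapply Rle_trans; [apply Rabs_triang|]. rewrite Rabs_Ropp, Rabs_mult, (Rabs_right 2) by lra.
  generalize (PS_incr_1_le _ K1 H1 r) (H0 r). lra.
Qed.

Lemma cheb_coef_PSeries (m : nat) (c : nat -> R) (K z : R) :
  (forall r, Rabs (c r) <= K) -> Rabs z < 1 ->
  PSeries (cheb_coef m c) z = chebyshev_U m z * PSeries c z.
Proof.
intros Hc Hz.
assert (Hex : forall m, ex_pseries (cheb_coef m c) z).
{ intros k. destruct (cheb_coef_bounded k c K Hc) as [K' HK'].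
  apply CV_radius_inside, (CV_radius_gt _ K'); assumption. }
pattern m. apply nat_pair_ind; clear m.
- simpl. rewrite Rmult_1_l. reflexivity.
- rewrite (PSeries_ext _ (PS_scal 2 (PS_incr_1 c))) by reflexivity.
  rewrite PSeries_scal, PSeries_incr_1. simpl. ring.
- intros m IH0 IH1.
  rewrite (PSeries_ext _ (PS_minus (PS_scal 2 (PS_incr_1 (cheb_coef (S m) c))) (cheb_coef m c)))
    by reflexivity.
  rewrite PSeries_minus, PSeries_scal, PSeries_incr_1, IH0, IH1.
  + change (chebyshev_U (S (S m)) z) with (2 * z * chebyshev_U (S m) z - chebyshev_U m z). ring.
  + apply ex_pseries_scal; [apply Rmult_comm|].
    apply ex_pseries_incr_1, Hex.
  + apply Hex.
Qed.

Lemma taylor_coef_chebyshev_asin (m q r : nat) :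
  taylor_coef (fun z => chebyshev_U m z * asin z ^ q) r =
  cheb_coef m (fun M => asin_coef M q) r.
Proof.
destruct (cheb_coef_bounded m _ _ (fun M => asin_coef_le M q)) as [K HK].
apply taylor_coef_PSeries.
- rewrite <- Rabs_R0. apply (CV_radius_gt _ K); [exact HK|]. rewrite Rabs_R0. lra.
- exists (mkposreal 1 Rlt_0_1). intros z Hz.
  assert (Hz1 : Rabs z < 1).
  { apply (proj1 (ball_R _ _ _)) in Hz. rewrite Rminus_0_r in Hz. exact Hz. }
  rewrite (cheb_coef_PSeries m _ _ z (fun M => asin_coef_le M q) Hz1).
  rewrite asin_pow_PSeries by exact Hz1. reflexivity.
Qed.

(** The step to [S (S m)] at [n] uses [S m] at [n] and [m] at [S n]: the first has one power of cosh
    less, which the factor [2 * cosh x] accounts for, and the second has the same power. The sum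
    [m + 2 * n] does not grow, so one [N] serves throughout. *)
Lemma expansion (eps N m n : nat) (x : R) : eps = 0%nat \/ eps = 1%nat ->
  (m + 2 * n <= 2 * N)%nat ->
  chebyshev_U m (cosh x) * sinh x / cosh x ^ S (m + (2 * n + 1 + eps)) =
  sum_f_R0 (fun p => cheb_coef m (fun M => asin_coef M (2 * p + 1 + eps)) (m + (2 * n + 1 + eps))
    * ser_im (2 * INR eps - 1) (S (2 * p + 1 + eps)) x) N.
Proof.
intros Heps. assert (Hx := cosh_pos x). set (s := 2 * INR eps - 1).
revert n. pattern m. apply nat_pair_ind; clear m.
- intros n Hn. simpl chebyshev_U. rewrite Rmult_1_l.
  apply (expansion_0 eps N n x Heps). lia.
- intros n Hn. set (M := (2 * n + 1 + eps)%nat).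
  transitivity (2 * (sinh x / cosh x ^ S M)).
  + simpl. field. split; [apply pow_nonzero; lra|lra].
  + unfold M. rewrite (expansion_0 eps N n x Heps) by lia. fold M s.
    rewrite scal_sum. apply sum_eq. intros p _.
    change (cheb_coef 1 (fun M => asin_coef M (2 * p + 1 + eps)) (1 + M)) with
      (2 * asin_coef M (2 * p + 1 + eps)). ring.
- intros m IH0 IH1 n Hn. specialize (IH1 n ltac:(lia)). specialize (IH0 (S n) ltac:(lia)).
  replace (m + (2 * S n + 1 + eps))%nat with (S (S (m + (2 * n + 1 + eps)))) in IH0 by lia.
  replace (S m + (2 * n + 1 + eps))%nat with (S (m + (2 * n + 1 + eps))) in IH1 by lia.
  replace (S (S m) + (2 * n + 1 + eps))%nat with (S (S (m + (2 * n + 1 + eps)))) by lia.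
  set (M := (m + (2 * n + 1 + eps))%nat) in *.
  transitivity (2 * (chebyshev_U (S m) (cosh x) * sinh x / cosh x ^ S (S M)) -
                chebyshev_U m (cosh x) * sinh x / cosh x ^ S (S (S M))).
  + change (chebyshev_U (S (S m)) (cosh x)) with
      (2 * cosh x * chebyshev_U (S m) (cosh x) - chebyshev_U m (cosh x)).
    set (u := chebyshev_U (S m) (cosh x)). set (v := chebyshev_U m (cosh x)).
    simpl pow. field. split; [apply pow_nonzero; lra|lra].
  + rewrite IH0, IH1. rewrite scal_sum, <- minus_sum. apply sum_eq. intros p _.
    change (cheb_coef (S (S m)) (fun M => asin_coef M (2 * p + 1 + eps)) (S (S M))) with
      (2 * cheb_coef (S m) (fun M => asin_coef M (2 * p + 1 + eps)) (S M)
       - cheb_coef m (fun M => asin_coef M (2 * p + 1 + eps)) (S (S M))). ring.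
Qed.

(** Since [cosh x >= 1], the trigonometric formula does not apply; the recurrence is matched with
    the hyperbolic addition formulas instead. *)
Lemma chebyshev_U_cosh (m : nat) (x : R) :
  chebyshev_U m (cosh x) * sinh x = sinh (INR (m + 1) * x).
Proof.
pattern m. apply nat_pair_ind; clear m.
- simpl. rewrite !Rmult_1_l. reflexivity.
- replace (INR (1 + 1) * x) with (x + x) by (simpl; ring). simpl.
  unfold sinh, cosh. rewrite Ropp_plus_distr, !exp_plus. field.
- intros m IH0 IH1.
  change (chebyshev_U (S (S m)) (cosh x)) with
    (2 * cosh x * chebyshev_U (S m) (cosh x) - chebyshev_U m (cosh x)).
  transitivity (2 * cosh x * sinh (INR (S m + 1) * x) - sinh (INR (m + 1) * x));
    [rewrite <- IH0, <- IH1; ring|].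
  replace (INR (S (S m) + 1) * x) with (INR (S m + 1) * x + x)
    by (rewrite !plus_INR, !S_INR; ring).
  replace (INR (m + 1) * x) with (INR (S m + 1) * x + - x)
    by (rewrite !plus_INR, !S_INR; ring).
  unfold sinh, cosh. rewrite !Ropp_plus_distr, Ropp_involutive, !exp_plus, !exp_Ropp.
  generalize (exp_pos (INR (S m + 1) * x)) (exp_pos x). intros H1 H2. field. lra.
Qed.

(** * Integration *)

Definition ser_rho (s : R) (q : nat) (x : R) : R :=
  Series (fun j => 2 * s ^ j * rho q (freq j) x).

Lemma ser_rho_term_le (s : R) (q j : nat) (x : R) : Rabs s <= 1 ->
  Rabs (2 * s ^ j * rho q (freq j) x) <= 2 * INR (q + 2) * / freq j ^ S q.
Proof.
intros Hs. rewrite Rmult_assoc with (r1 := 2) (r2 := INR (q + 2)).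
apply scaled_term_le; [exact Hs|]. apply rho_le, freq_pos.
Qed.

Lemma is_derive_ser_rho (s : R) (q : nat) (x : R) : Rabs s <= 1 -> 0 < x ->
  is_derive (ser_rho s (S q)) x (ser_im s (S (S q)) x / x).
Proof.
intros Hs Hx. unfold ser_im, Rdiv. rewrite <- Series_scal_r.
(* On the ball of radius [x / 2] one has [/ y <= 2 / x], the source of the factor [2 / x] in the
   majorant. *)
assert (Hx2 : 0 < x / 2) by lra.
apply (is_derive_Series (fun j y => 2 * s ^ j * rho (S q) (freq j) y)
   (fun j y => 2 * s ^ j * cim (S (S q)) (freq j) y * / y)
   (fun j => (2 * (2 / x)) * / freq j ^ S (S q)) x (mkposreal _ Hx2)); simpl pos.
- apply ex_series_2_inv_freq.
- intros j y Hy. apply Rabs_def2 in Hy. rewrite Rmult_assoc.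
  apply is_derive_scal, is_derive_rho; [apply freq_pos|lra].
- intros j y Hy. apply Rabs_def2 in Hy.
  assert (Hi : 0 < / y) by (apply Rinv_0_lt_compat; lra).
  rewrite Rabs_mult, (Rabs_right (/ y)) by lra.
  replace (2 * (2 / x) * / freq j ^ S (S q)) with (2 * / freq j ^ S (S q) * / (x / 2))
    by (field; split; [apply pow_nonzero; generalize (freq_pos j); lra|lra]).
  apply Rmult_le_compat; [apply Rabs_pos|lra| |apply Rinv_le_contravar; lra].
  apply scaled_term_le; [exact Hs|]. apply cre_cim_le, freq_pos.
- intros y _. apply (ex_series_Rabs_le _ _ (fun j => ser_rho_term_le s (S q) j y Hs)).
  apply ex_series_2_inv_freq.
Qed.

Lemma filterlim_scal_R {T : Type} {F : (T -> Prop) -> Prop} {FF : Filter F}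
    (c : R) (f : T -> R) (l : R) :
  filterlim f F (locally l) -> filterlim (fun t => c * f t) F (locally (c * l)).
Proof.
intros H. eapply filterlim_comp; [exact H|].
apply (filterlim_scal_r (V := R_NormedModule) c l).
Qed.

Lemma ser_rho_lim_p_infty (s : R) (q : nat) : Rabs s <= 1 ->
  filterlim (ser_rho s (S q)) (Rbar_locally p_infty)
    (locally (Series (fun j => 2 * s ^ j * (PI / 2 * / freq j ^ S (S q))))).
Proof.
intros Hs. apply (tannery _ _ (fun j => 2 * INR (S q + 2) * / freq j ^ S (S q))).
- apply ex_series_2_inv_freq.
- intros j. apply filterlim_scal_R, rho_lim, freq_pos.
- apply filter_forall. intros x j. apply ser_rho_term_le, Hs.
Qed.

Lemma ser_rho_lim_0 (s : R) (q : nat) : Rabs s <= 1 ->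
  filterlim (ser_rho s (S q)) (at_right 0) (locally 0).
Proof.
intros Hs.
assert (H : filterlim (ser_rho s (S q)) (at_right 0)
   (locally (Series (fun j => 2 * s ^ j * rho (S q) (freq j) 0)))).
{ apply (tannery _ _ (fun j => 2 * INR (S q + 2) * / freq j ^ S (S q))).
  - apply ex_series_2_inv_freq.
  - intros j. apply filterlim_scal_R.
    intros P HP. unfold filtermap, at_right, within.
    generalize (continuous_rho (S q) (freq j) 0 (freq_pos j) P HP).
    apply (filter_imp (F := locally 0)). auto.
  - apply filter_forall. intros x j. apply ser_rho_term_le, Hs. }
replace 0 with (Series (fun j => 2 * s ^ j * rho (S q) (freq j) 0)) at 2; [exact H|].
apply is_series_unique. apply (is_series_ext (fun _ => 0)).
- intros j. rewrite rho_0, Rmult_0_r. reflexivity.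
- change (is_lim_seq (sum_n (fun _ => 0)) 0).
  apply (is_lim_seq_ext (fun _ => 0)); [|apply is_lim_seq_const].
  intros n. rewrite sum_n_const. ring.
Qed.

(** Termwise, [freq j ^ S q] contains [PI ^ S q], and one factor [PI] cancels against the [PI / 2]
    from the arctangent. *)
Lemma lerch_phi_freq (s : R) (q : nat) :
  lerch_phi s (INR (S q)) (1 / 2) / PI ^ q =
  Series (fun j => 2 * s ^ j * (PI / 2 * / freq j ^ S q)).
Proof.
assert (HP := PI_ge_3). assert (Hp : PI ^ q <> 0) by (apply pow_nonzero; lra).
unfold lerch_phi, Rdiv. rewrite <- Series_scal_r. apply Series_ext. intros j.
assert (Hj := pos_INR j). rewrite Rpower_pow by lra.
unfold freq, Rdiv. rewrite Rpow_mult_distr.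
assert (Hp2 : (INR j + 1 * / 2) ^ S q <> 0) by (apply pow_nonzero; lra).
simpl (PI ^ S q). field. repeat split; auto; lra.
Qed.

Lemma sum_filterlim {F : (R -> Prop) -> Prop} {FF : Filter F}
    (f : nat -> R -> R) (l : nat -> R) (N : nat) :
  (forall p, filterlim (f p) F (locally (l p))) ->
  filterlim (fun t => sum_f_R0 (fun p => f p t) N) F (locally (sum_f_R0 l N)).
Proof.
intros H. induction N as [|N IH]; [apply H|]. simpl.
apply (filterlim_comp_2 (G := locally (sum_f_R0 l N)) (H := locally (l (S N)))
         _ _ Rplus IH (H (S N))).
apply (filterlim_plus (V := R_NormedModule)).
Qed.

(** Eventually both bounds of integration are positive, so the fundamental theorem is applied away
    from 0, where the integrand has a division by zero. *)
Lemma is_RInt_gen_0_infty (f g : R -> R) (la lb : R) :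
  (forall x, 0 < x -> is_derive f x (g x)) ->
  (forall x, 0 < x -> continuous g x) ->
  filterlim f (at_right 0) (locally la) ->
  filterlim f (Rbar_locally p_infty) (locally lb) ->
  is_RInt_gen g (at_right 0) (Rbar_locally p_infty) (lb - la).
Proof.
intros Hd Hc Ha Hb.
assert (Hpos : filter_prod (at_right 0) (Rbar_locally p_infty)
  (fun ab => 0 < Rmin (fst ab) (snd ab))).
{ exists (fun a => 0 < a) (fun b => 0 < b).
  - exists (mkposreal 1 Rlt_0_1). intros y _ Hy. exact Hy.
  - exists 0. auto.
  - intros a b H1 H2. simpl. apply Rmin_pos; assumption. }
apply (is_RInt_gen_ext (Derive f)).
- revert Hpos. apply filter_imp. intros [a b] Hab x Hx. apply is_derive_unique, Hd. lra.
- apply (is_RInt_gen_Derive f la lb); try assumption.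
  + revert Hpos. apply filter_imp. intros [a b] Hab x Hx. eexists. apply Hd. lra.
  + revert Hpos. apply filter_imp. intros [a b] Hab x Hx. simpl in Hab, Hx.
    assert (H0 : 0 < x) by lra.
    apply (continuous_ext_loc _ g); [|apply Hc, H0].
    exists (mkposreal x H0). intros y Hy.
    apply (proj1 (ball_R _ _ _)) in Hy. simpl in Hy.
    apply Rabs_def2 in Hy. symmetry. apply is_derive_unique, Hd. lra.
Qed.

Theorem proposition3p1 (n k eps : nat)
  (hn : (1 <= n)%nat) (hk : (k < n)%nat)
  (heps : eps = 0%nat \/ eps = 1%nat) :
  is_RInt_gen
    (fun x : R => sinh (INR (2 * k + 1) * x) / (x * cosh x ^ (2 * n + eps)))
    (at_right 0) (Rbar_locally p_infty)
    (sum_n_m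
       (fun p : nat =>
          lerch_phi (2 * INR eps - 1) (INR (2 * p + eps)) (1 / 2)
            / PI ^ (2 * p - 1 + eps)
          * taylor_coef
              (fun z : R => chebyshev_U (2 * k) z * asin z ^ (2 * p - 1 + eps))
              (2 * n - 1 + eps))
       1 n).
Proof.
(* With [n = S N] and [p] shifted by one, the truncated exponents [2 * p - 1 + eps] become
   [2 * p + 1 + eps]. *)
destruct n as [|N]; [lia|]. set (s := 2 * INR eps - 1).
assert (Hs : Rabs s <= 1).
{ unfold s. destruct heps as [-> | ->]; simpl; apply Rabs_le_between; lra. }
set (c := fun p => cheb_coef (2 * k) (fun M => asin_coef M (2 * p + 1 + eps)) (2 * N + 1 + eps)).
(* For [q >= 1], the integral of [ser_im s (S q) x / x] over the half line. *)
set (L := fun q => Series (fun j => 2 * s ^ j * (PI / 2 * / freq j ^ S q))).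
assert (Hval : sum_n_m (fun p => lerch_phi s (INR (2 * p + eps)) (1 / 2)
            / PI ^ (2 * p - 1 + eps)
          * taylor_coef
              (fun z : R => chebyshev_U (2 * k) z * asin z ^ (2 * p - 1 + eps))
              (2 * S N - 1 + eps)) 1 (S N) = sum_f_R0 (fun p => c p * L (2 * p + 1 + eps)%nat) N - 0).
{ rewrite <- sum_n_m_S, Rminus_0_r. etransitivity; [|apply sum_n_Reals].
  apply sum_n_m_ext. intros p. rewrite taylor_coef_chebyshev_asin.
  replace (2 * S p - 1 + eps)%nat with (2 * p + 1 + eps)%nat by lia.
  replace (2 * S N - 1 + eps)%nat with (2 * N + 1 + eps)%nat by lia.
  replace (2 * S p + eps)%nat with (S (2 * p + 1 + eps)) by lia.
  rewrite lerch_phi_freq. apply Rmult_comm. }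
rewrite Hval. clear Hval.
assert (Hq : forall p, (2 * p + 1 + eps)%nat = S (2 * p + eps)) by (intros; lia).
apply (is_RInt_gen_0_infty
  (fun x => sum_f_R0 (fun p => c p * ser_rho s (2 * p + 1 + eps) x) N)).
- intros x Hx.
  replace (sinh (INR (2 * k + 1) * x) / (x * cosh x ^ (2 * S N + eps))) with
    (sum_f_R0 (fun p => c p * (ser_im s (S (2 * p + 1 + eps)) x / x)) N).
  + apply is_derive_sum_f. intros p. apply is_derive_scal. rewrite Hq.
    apply is_derive_ser_rho; assumption.
  + rewrite <- chebyshev_U_cosh.
    (* The factor [U_(2k)] takes [2 * k] of the degree [2 * N + 1 + eps]; [k <= N] makes the
       subtraction exact. *)
    assert (H := expansion eps N (2 * k) (N - k) x heps ltac:(lia)).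
    replace (2 * k + (2 * (N - k) + 1 + eps))%nat with (2 * N + 1 + eps)%nat in H by lia.
    fold s in H. replace (2 * S N + eps)%nat with (S (2 * N + 1 + eps)) by lia.
    assert (Hc : cosh x ^ S (2 * N + 1 + eps) <> 0)
      by (apply pow_nonzero; generalize (cosh_pos x); lra).
    transitivity (chebyshev_U (2 * k) (cosh x) * sinh x / cosh x ^ S (2 * N + 1 + eps) * / x).
    * rewrite H. rewrite Rmult_comm, scal_sum. apply sum_eq. intros p _. unfold c, Rdiv. ring.
    * field. split; [exact Hc|lra].
- intros x Hx. apply (ex_derive_continuous (V := R_NormedModule)).
  auto_derive. apply Rmult_integral_contrapositive_currified; [lra|].
  apply (pow_nonzero (cosh x) (2 * S N + eps)). generalize (cosh_pos x). lra.
- replace 0 with (sum_f_R0 (fun p => c p * 0) N) at 2.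
  + apply (sum_filterlim (fun p x => c p * ser_rho s (2 * p + 1 + eps) x)).
    intros p. apply filterlim_scal_R. rewrite Hq. apply ser_rho_lim_0, Hs.
  + rewrite <- scal_sum. ring.
- apply (sum_filterlim (fun p x => c p * ser_rho s (2 * p + 1 + eps) x)).
  intros p. apply filterlim_scal_R. unfold L. rewrite Hq. apply ser_rho_lim_p_infty, Hs.
Qed.
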